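(* Let $\Gamma$ be a nonelementary discrete subgroup of $\mathrm{SU}(n,1)$ whose trace field is contained in $\mathbb R$. Then $\Gamma$ is conjugate either to a subgroup of $\mathrm{S}(\mathrm{U}(n-m)\oplus\mathrm{O}(m,1))$ for some $m\ge 2$, or to a subgroup of $\mathrm{SU}(n-1)\oplus\mathrm{SU}(1,1)$.
   Context: $\mathrm{SU}(n,1)$ is the group of complex $(n+1)\times(n+1)$ matrices of determinant $1$ preserving the Hermitian form $w^*I_{n,1}z$, $I_{n,1}=\mathrm{diag}(1,\dots,1,-1)$, acting on complex hyperbolic space $\mathbf H^n_{\mathbb C}$; nonelementary means the limit set in $\partial\mathbf H^n_{\mathbb C}$ has more than two points. The trace field is the field generated over $\mathbb Q$ by the traces of the elements of $\Gamma$. $A\oplus B$ is the block diagonal matrix with blocks $A$ (acting on the first coordinates) and $B$ (acting on the last coordinates); $\mathrm{O}(m,1)$ is the group of real matrices preserving $\mathrm{diag}(1,\dots,1,-1)$; $\mathrm{S}(\mathrm{U}(n-m)\oplus\mathrm{O}(m,1))$ denotes the block diagonal matrices $A\oplus B$ with $A\in\mathrm{U}(n-m)$, $B\in\mathrm{O}(m,1)$ and determinant $1$. *)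

(* Defs.v *)
From HB Require Import structures.
From mathcomp Require Import all_boot all_order all_algebra.
From mathcomp Require Import complex.
From mathcomp Require Import reals.
Set Implicit Arguments. Unset Strict Implicit. Unset Printing Implicit Defensive.
Import Order.TTheory GRing.Theory Num.Theory.
Local Open Scope ring_scope.
Local Open Scope complex_scope.

Section Defs.
Variable R : realType.
Local Notation C := R[i].

Definition hadj {p q : nat} (A : 'M[C]_(p, q)) : 'M[C]_(q, p) :=
  (map_mx Num.conj A)^T.

Definition Jform (m : nat) : 'M[C]_m.+1 :=
  diag_mx (\row_(i < m.+1) (if i == ord_max then -1 else 1)).

Definition inSU_n1 (n : nat) (g : 'M[C]_n.+1) : Prop :=
  hadj g *m Jform n *m g = Jform n /\ \det g = 1.

Definition inU (k : nat) (A : 'M[C]_k) : Prop := hadj A *m A = 1%:M.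
Definition inSU (k : nat) (A : 'M[C]_k) : Prop := inU A /\ \det A = 1.

Definition inO_m1 (m : nat) (B : 'M[C]_m.+1) : Prop :=
  (forall i j, B i j \is Num.real) /\ B^T *m Jform m *m B = Jform m.

Definition is_subgroup_SU_n1 (n : nat) (G : 'M[C]_n.+1 -> Prop) : Prop :=
  G 1%:M /\ (forall g h, G g -> G h -> G (g *m h)) /\
  (forall g, G g -> G (invmx g)) /\ (forall g, G g -> inSU_n1 g).

Definition discrete_set (N : nat) (G : 'M[C]_N -> Prop) : Prop :=
  forall g, G g -> exists eps : C, 0 < eps /\
    forall h, G h -> h <> g -> exists i j, eps <= `|h i j - g i j|.

(* Ball model: a point of H^n_C is the negative line through (w,1), |w|<1;
   the boundary is the unit sphere |w| = 1 in C^n.  The image of the base point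
   0 (the line through (0,...,0,1)) under g is the point with coordinates
   g_{i,n} / g_{n,n}. *)
Definition orbit0 (n : nat) (g : 'M[C]_n.+1) : 'rV[C]_n :=
  \row_(i < n) (g (widen_ord (leqnSn n) i) ord_max / g ord_max ord_max).

Definition in_sphere (n : nat) (xi : 'rV[C]_n) : Prop :=
  \sum_(i < n) `|xi 0 i| ^+ 2 = 1.

(* limit set: boundary points in the closure of the orbit of the base point
   (equivalently, accumulation points in the boundary of that orbit). *)
Definition limit_set (n : nat) (G : 'M[C]_n.+1 -> Prop) (xi : 'rV[C]_n) : Prop :=
  in_sphere xi /\
  forall eps : C, 0 < eps -> exists g, G g /\ forall i, `|orbit0 g 0 i - xi 0 i| < eps.

Definition nonelementary (n : nat) (G : 'M[C]_n.+1 -> Prop) : Prop :=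
  exists xi1 xi2 xi3, limit_set G xi1 /\ limit_set G xi2 /\ limit_set G xi3 /\
    xi1 <> xi2 /\ xi1 <> xi3 /\ xi2 <> xi3.

Definition is_subfield (S : C -> Prop) : Prop :=
  S 0 /\ S 1 /\ (forall x y, S x -> S y -> S (x + y)) /\ (forall x, S x -> S (- x)) /\
  (forall x y, S x -> S y -> S (x * y)) /\ (forall x, S x -> x != 0 -> S x^-1).

Definition trace_field (N : nat) (G : 'M[C]_N -> Prop) (x : C) : Prop :=
  forall S, is_subfield S -> (forall g, G g -> S (\tr g)) -> S x.

Definition inSUO (n m : nat) (g : 'M[C]_n.+1) : Prop :=
  exists (e : (n - m + m.+1 = n.+1)%N) (A : 'M[C]_(n - m)) (B : 'M[C]_m.+1),
    inU A /\ inO_m1 B /\ g = castmx (e, e) (block_mx A 0 0 B) /\ \det g = 1.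

Definition inSU_SU11 (n : nat) (g : 'M[C]_n.+1) : Prop :=
  exists (e : (n.-1 + 2 = n.+1)%N) (A : 'M[C]_(n.-1)) (B : 'M[C]_2),
    inSU A /\ inSU_n1 (B : 'M[C]_1.+1) /\ g = castmx (e, e) (block_mx A 0 0 B).

Definition conj_into (n : nat) (G P : 'M[C]_n.+1 -> Prop) : Prop :=
  exists h, inSU_n1 h /\ forall g, G g -> P (invmx h *m g *m h).

End Defs.

(* Main.v *)
Require Import Defs.
From HB Require Import structures.
From mathcomp Require Import all_boot all_order all_algebra.
From mathcomp Require Import complex.
From mathcomp Require Import reals boolp.
From mathcomp Require Import ring lra.
Set Implicit Arguments. Unset Strict Implicit. Unset Printing Implicit Defensive.
Import Order.TTheory GRing.Theory Num.Theory.
Local Open Scope ring_scope.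

(** With [<x, y> = x^* J y], bounded traces are incompatible with two limit
    points, so some element [h] of the group has a trace of modulus [> n + 1]
    and is loxodromic: [h v = lam v], [h u = conj(lam)^-1 u], with [v], [u] null
    and [<u, v> = 1].  Since [h^k = lam^k v u^* J + O(1)], reality of the traces
    of [h^k g] makes [lam] and every [<u, g v>] real, and applying this to
    [g h^-k g'] makes every product [<u, g u> <v, g' v>] real.  Discreteness
    forbids a common fixed point [v] (or [u]), so the numbers [<v, g v>] and
    [<u, g u>] are either all real or all imaginary.

    In the imaginary case the orbit of [v] and [u] stays in their complex span,
    a hyperbolic plane on which the group acts with determinant 1.  In the real
    case the real span of the orbit is a real form, and real Gram-Schmidt gives
    the [O(m,1)] block; [m = 1] is excluded, as the group would then permute the
    two null lines and have at most two limit points. *)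

(** For the loxodromic element, every [g] is a rank-one matrix scaled by its corner entry plus a
    remainder with entries of modulus at most 1. Bounded traces force [g] and its inverse to send
    the base point near the same limit point. For [g] and [h] close to distinct limit points, with
    lifts [x] and [y], the trace of [g h] then has modulus about [|<x, y>|^2] times both corner
    entries, and distinct boundary points never pair to 0.

    All positivity comes from one fact: the form is semidefinite on the complement of a null vector,
    hence definite on the complement of [v] and [u]. It bounds the powers of [h] there, kills null
    components in the imaginary case, and lets Gram-Schmidt, started from [v + u] and [v - u], meet
    only positive vectors.

    A common fixed point is excluded in two stages: by discreteness, elements fixing the line of [v]
    fix that of [u]; and a group preserving the pair of lines keeps [|<v, x>| |<u, x>|] constant
    along orbits, which can then accumulate only at these two points.

    The frame found has a determinant of modulus 1 only; scaling by an [n + 1]-th root corrects it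
    without changing the conjugation. *)

Section Adjoint.
Variable R : realType.
Local Notation C := R[i].

Lemma hadjE p q (A : 'M[C]_(p, q)) i j : hadj A i j = (A j i)^*.
Proof. by rewrite !mxE. Qed.

Lemma hadjM p q r (A : 'M[C]_(p, q)) (B : 'M[C]_(q, r)) :
  hadj (A *m B) = hadj B *m hadj A.
Proof. by rewrite /hadj map_mxM trmx_mul. Qed.

Lemma hadjK p q (A : 'M[C]_(p, q)) : hadj (hadj A) = A.
Proof. by apply/matrixP=> i j; rewrite !hadjE conjCK. Qed.

Lemma hadj1 p : hadj (1%:M : 'M[C]_p) = 1%:M.
Proof. by rewrite /hadj map_mx1 trmx1. Qed.

Lemma hadjD p q (A B : 'M[C]_(p, q)) : hadj (A + B) = hadj A + hadj B.
Proof. by rewrite /hadj map_mxD linearD. Qed.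

Lemma hadjZ p q a (A : 'M[C]_(p, q)) : hadj (a *: A) = a^* *: hadj A.
Proof. by rewrite /hadj map_mxZ linearZ. Qed.

Lemma hadj0 p q : hadj (0 : 'M[C]_(p, q)) = 0.
Proof. by rewrite /hadj map_mx0 trmx0. Qed.

Lemma hadj_row_mx p q r (A : 'M[C]_(p, q)) (B : 'M[C]_(p, r)) :
  hadj (row_mx A B) = col_mx (hadj A) (hadj B).
Proof. by rewrite /hadj map_row_mx tr_row_mx. Qed.

Lemma det_hadj p (A : 'M[C]_p) : \det (hadj A) = (\det A)^*.
Proof. by rewrite /hadj det_tr det_map_mx. Qed.

Lemma Jform_involutive m : Jform R m *m Jform R m = 1%:M.
Proof.
rewrite /Jform mulmx_diag -diag_const_mx; congr diag_mx; apply/rowP=> i.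
by rewrite !mxE; case: ifP; rewrite ?mulr1 // mulrNN mulr1.
Qed.

Lemma hadj_Jform m : hadj (Jform R m) = Jform R m.
Proof.
apply/matrixP=> i j; rewrite hadjE !mxE; have [->|ij] := eqVneq i j.
  by rewrite !mulr1n; case: ifP; rewrite ?rmorphN rmorph1.
by rewrite !mulr0n conjC0.
Qed.

Lemma Jform_block m : Jform R m.+1 = block_mx (1%:M : 'M_1) 0 0 (Jform R m) :> 'M_(1 + m.+1).
Proof.
apply/matrixP=> i j; rewrite [LHS]mxE !mxE.
case: (splitP i) => i' Hi; rewrite !mxE; case: (splitP j) => j' Hj; rewrite !mxE -!val_eqE /= ?Hi ?Hj ?ord1 //=.
Qed.
End Adjoint.

(** * The Hermitian form *)
Section Form.
Variables (R : realType) (n : nat).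
Local Notation C := R[i].
Local Notation J := (Jform R n).
Local Notation V := 'cV[C]_n.+1.
Local Notation M := 'M[C]_n.+1.

Definition ip (x y : V) : C := (hadj x *m J *m y) 0 0.

Definition preserves (g : M) : Prop := hadj g *m J *m g = J.

Definition spatial (x : V) : C := \sum_(i < n) `|x (lift ord_max i) 0| ^+ 2.

Lemma ip_mx (x y : V) : hadj x *m J *m y = (ip x y)%:M.
Proof. by rewrite [LHS]mx11_scalar. Qed.

Lemma ipE x y : ip x y =
  \sum_(i < n) (x (lift ord_max i) 0)^* * y (lift ord_max i) 0 - (x ord_max 0)^* * y ord_max 0.
Proof.
rewrite /ip mul_mx_diag mxE (bigD1 ord_max) //= !mxE eqxx mulrN1 mulNr addrC; congr (_ - _).
rewrite (reindex_omap (lift ord_max) (unlift ord_max)); last first.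
  by move=> i; case: unliftP => [j ->|->] //; rewrite eqxx.
apply: eq_big => [i|i _]; first by rewrite liftK eqxx andbT eq_sym neq_lift.
by rewrite !mxE eq_sym (negPf (neq_lift _ _)) mulr1.
Qed.

Lemma ipxx x : ip x x = spatial x - `|x ord_max 0| ^+ 2.
Proof.
rewrite ipE /spatial normCK [X in _ - X]mulrC; congr (_ - _).
by apply: eq_bigr => i _; rewrite normCK mulrC.
Qed.

Lemma ipDr x y z : ip x (y + z) = ip x y + ip x z.
Proof. by rewrite /ip mulmxDr mxE. Qed.
Lemma ipDl x y z : ip (x + y) z = ip x z + ip y z.
Proof. by rewrite /ip hadjD !mulmxDl mxE. Qed.
Lemma ipZr a x y : ip x (a *: y) = a * ip x y.
Proof. by rewrite /ip -scalemxAr mxE. Qed.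
Lemma ipZl a x y : ip (a *: x) y = a^* * ip x y.
Proof. by rewrite /ip hadjZ -!scalemxAl mxE. Qed.
Lemma ipNr x y : ip x (- y) = - ip x y.
Proof. by rewrite -scaleN1r ipZr mulN1r. Qed.
Lemma ipNl x y : ip (- x) y = - ip x y.
Proof. by rewrite -scaleN1r ipZl rmorphN rmorph1 mulN1r. Qed.
Lemma ip0r x : ip x 0 = 0.
Proof. by rewrite -(scale0r x) ipZr mul0r. Qed.
Lemma ip0l x : ip 0 x = 0.
Proof. by rewrite -(scale0r x) ipZl conjC0 mul0r. Qed.
Definition ip_lin := (ipDr, ipDl, ipNr, ipNl, ipZr, ipZl, ip0r, ip0l).

Lemma ipC x y : ip y x = (ip x y)^*.
Proof.
rewrite -[LHS](conjCK); congr (_^*); rewrite /ip -hadjE.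
by rewrite !hadjM hadj_Jform hadjK mulmxA.
Qed.

Lemma preserves_ip g x y : preserves g -> ip (g *m x) (g *m y) = ip x y.
Proof.
move=> hg; rewrite /ip hadjM -[in RHS]hg; by rewrite !mulmxA.
Qed.

Lemma preserves1 : preserves 1%:M.
Proof. by rewrite /preserves hadj1 mul1mx mulmx1. Qed.

Lemma preservesM g h : preserves g -> preserves h -> preserves (g *m h).
Proof.
move=> hg hh; rewrite /preserves hadjM -[RHS]hh -[in RHS]hg; by rewrite !mulmxA.
Qed.

Lemma preserves_invE g : preserves g -> J *m hadj g *m J *m g = 1%:M.
Proof. by move=> hg; rewrite -!mulmxA (mulmxA (hadj g)) hg Jform_involutive. Qed.

Lemma preserves_unit g : preserves g -> g \in unitmx.
Proof. by move=> /preserves_invE/mulmx1_unit[]. Qed.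

Lemma preserves_inv g : preserves g -> invmx g = J *m hadj g *m J.
Proof.
move=> hg; have gu := preserves_unit hg.
by rewrite -[RHS]mulmx1 -(mulmxV gu) mulmxA preserves_invE // mul1mx.
Qed.

Lemma preservesV g : preserves g -> preserves (invmx g).
Proof.
move=> hg; have gu := preserves_unit hg.
rewrite /preserves -[in LHS]hg -!mulmxA mulmxV // mulmx1 mulmxA -hadjM mulmxV //.
by rewrite hadj1 mul1mx.
Qed.

Lemma preserves_ipl g x y : preserves g -> ip (g *m x) y = ip x (invmx g *m y).
Proof.
by move=> hg; rewrite -(preserves_ip x _ hg) mulmxA mulmxV ?preserves_unit // mul1mx.
Qed.

Lemma spatial_ge0 x : 0 <= spatial x.
Proof. by apply: sumr_ge0 => i _; rewrite exprn_ge0. Qed.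

Lemma spatial_le (x : V) i : x ord_max 0 = 0 -> `|x i 0| ^+ 2 <= spatial x.
Proof.
move=> x0; case: (unliftP ord_max i) => [j|] ->; last by rewrite x0 normr0 expr0n spatial_ge0.
rewrite /spatial (bigD1 j) //= lerDl; apply: sumr_ge0 => k _; by rewrite exprn_ge0.
Qed.

Lemma spatial_eq0 (x : V) : x ord_max 0 = 0 -> spatial x = 0 -> x = 0.
Proof.
move=> x0 s0; apply/colP=> i; rewrite [RHS]mxE; apply/eqP; rewrite -normr_eq0 -sqrf_eq0.
by rewrite eq_le exprn_ge0 // andbT -s0 spatial_le.
Qed.

Lemma null_last (z : V) : ip z z = 0 -> z != 0 -> z ord_max 0 != 0.
Proof.
move=> zz; apply: contraNneq => z0; apply/eqP/spatial_eq0 => //.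
by move: zz; rewrite ipxx z0 normr0 expr0n subr0.
Qed.

(* Subtracting a multiple of the null vector [z] does not change [ip x x] and
   kills the only negative coordinate. *)
Lemma null_orth z x : ip z z = 0 -> z != 0 -> ip z x = 0 ->
  let t := x ord_max 0 / z ord_max 0 in
  ip x x = spatial (x - t *: z) /\ (x - t *: z) ord_max 0 = 0.
Proof.
move=> zz z0 zx t; have zl := null_last zz z0.
have l0 : (x - t *: z) ord_max 0 = 0 by rewrite !mxE divfK // subrr.
split=> //; have <- : ip (x - t *: z) (x - t *: z) = ip x x.
  by rewrite !ip_lin zz zx (ipC z x) zx conjC0; ring.
by rewrite ipxx l0 normr0 expr0n subr0.
Qed.

Lemma null_orth_ge0 z x : ip z z = 0 -> z != 0 -> ip z x = 0 -> 0 <= ip x x.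
Proof. by move=> zz z0 zx; have [-> _] := null_orth zz z0 zx; exact: spatial_ge0. Qed.

Lemma null_orth_prop z x : ip z z = 0 -> z != 0 -> ip z x = 0 -> ip x x = 0 ->
  exists t, x = t *: z.
Proof.
move=> zz z0 zx xx; have [s0 l0] := null_orth zz z0 zx.
exists (x ord_max 0 / z ord_max 0); apply/eqP; rewrite -subr_eq0; apply/eqP/spatial_eq0 => //.
by rewrite -s0.
Qed.

Definition hyperbolic_pair (v u : V) : Prop := [/\ ip v v = 0, ip u u = 0 & ip u v = 1].

Lemma hyperbolic_pairC v u : hyperbolic_pair v u -> hyperbolic_pair u v.
Proof. by move=> [vv uu uv]; split=> //; rewrite ipC uv conjC1. Qed.

Lemma hyperbolic_pair_neq0 v u : hyperbolic_pair v u -> v != 0.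
Proof.
move=> [_ _ uv]; apply/eqP => v0; move: uv; rewrite v0 ip0r => /eqP.
by rewrite eq_sym oner_eq0.
Qed.

(** The complement of a hyperbolic pair is definite: a null vector orthogonal to [v] is a multiple
    of [v], and pairing with [u] reads off the multiple. *)
Lemma orth_pair_eq0 v u w : hyperbolic_pair v u -> ip v w = 0 -> ip u w = 0 ->
  ip w w = 0 -> w = 0.
Proof.
move=> hp vw uw ww; have [vv uu uv] := hp.
have [t wt] := null_orth_prop vv (hyperbolic_pair_neq0 hp) vw ww.
by move: uw; rewrite wt ipZr uv mulr1 => ->; rewrite scale0r.
Qed.

Lemma sqr_le_bound (x a : C) : 0 <= x -> x ^+ 2 <= a -> x <= a + 1.
Proof.
move=> x0 xa; have a0 : 0 <= a by apply: le_trans xa; rewrite exprn_ge0.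
have [x1|x1] := real_leP (ger0_real x0) (@real1 C).
  by apply: le_trans x1 _; rewrite lerDr.
apply: le_trans (_ : x ^+ 2 <= _); first by rewrite expr2 ler_peMl // ltW.
by apply: le_trans xa _; rewrite lerDl.
Qed.

(** On the complement of the pair the form controls all coordinates. Removing a multiple [t *: v]
    kills the last coordinate, so the rest has Euclidean norm given by [ip w w]; orthogonality to
    [u] then determines [t] from that rest. *)
Lemma orth_pair_bound v u : hyperbolic_pair v u ->
  exists K, 0 <= K /\ forall w, ip v w = 0 -> ip u w = 0 ->
    forall i, `|w i 0| <= K * (ip w w + 1).
Proof.
move=> hp; have [vv uu uv] := hp; have v0 := hyperbolic_pair_neq0 hp.
pose a := \sum_j `|u j 0|; pose b := \sum_j `|v j 0|.
have a0 : 0 <= a by apply: sumr_ge0.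
have b0 : 0 <= b by apply: sumr_ge0.
exists (1 + a * b); split=> [|w vw uw i]; first by rewrite addr_ge0 // mulr_ge0.
have [s0 l0] := null_orth vv v0 vw; set t := _ / _ in s0 l0.
set w' := w - t *: v in s0 l0.
have ww : 0 <= ip w w by rewrite s0 spatial_ge0.
have w'b j : `|w' j 0| <= ip w w + 1.
  by apply: sqr_le_bound; rewrite // s0 spatial_le.
have wE : w = w' + t *: v by rewrite subrK.
have tE : t = - ip u w' by apply/eqP; rewrite -subr_eq0 opprK; apply/eqP; rewrite -[RHS]uw [in RHS]wE !ip_lin uv mulr1 addrC.
have tb : `|t| <= a * (ip w w + 1).
  rewrite tE normrN ipE l0 mulr0 subr0; apply: le_trans (ler_norm_sum _ _ _) _.
  rewrite /a mulr_suml (bigD1 ord_max) //= ler_wpDl ?mulr_ge0 ?addr_ge0 //.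
  rewrite [leRHS](reindex_omap (lift ord_max) (unlift ord_max)); last first.
    by move=> j; case: unliftP => [k ->|->] //; rewrite eqxx.
  rewrite [leRHS](eq_bigl xpredT); last first.
    by move=> j; rewrite /= liftK eqxx andbT eq_sym neq_lift.
  by apply: ler_sum => j _; rewrite normrM norm_conjC ler_wpM2l.
rewrite {1}wE mxE; apply: le_trans (ler_normD _ _) _; rewrite mulrDl mul1r lerD // mxE normrM.
rewrite mulrAC ler_pM //; rewrite /b (bigD1 i) //= lerDl sumr_ge0 //.
Qed.

End Form.

(** * Powers of loxodromic elements *)
Section Growth.
Variable R : realType.
Local Notation C := R[i].

Lemma complex_archi (x : C) : 0 <= x -> exists N : nat, x < N%:R.
Proof.
move=> x0; have xE : x = (complex.Re x)%:C%C by rewrite RRe_real // ger0_real.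
have r0 : 0 <= complex.Re x by rewrite -lecR -xE.
exists (Num.bound (complex.Re x)).
by rewrite xE -(rmorph_nat (real_complex R)) ltcR archi_boundP.
Qed.

Lemma pow_unbounded (a B : C) : 1 < a -> 0 <= B -> exists k, B < a ^+ k.
Proof.
move=> a1 B0; have a0 : 0 < a - 1 by rewrite subr_gt0.
have [N BN] := complex_archi (divr_ge0 B0 (ltW a0)).
have bern k : 1 + k%:R * (a - 1) <= a ^+ k.
  elim: k => [|k IH]; first by rewrite mul0r addr0.
  rewrite exprSr; have: (1 + k%:R * (a - 1)) * a <= a ^+ k * a.
    by rewrite ler_wpM2r // (le_trans ler01 (ltW a1)).
  apply: le_trans; rewrite -subr_ge0.
  have -> : (1 + k%:R * (a - 1)) * a - (1 + k.+1%:R * (a - 1)) = k%:R * (a - 1) ^+ 2.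
    by rewrite -[in k.+1]addn1 natrD; ring.
  by rewrite mulr_ge0 // exprn_ge0 // ltW.
exists N; apply: lt_le_trans (bern N); rewrite ltr_wpDl // -ltr_pdivrMr //.
Qed.

Lemma bounded_growth_eq0 (lam c B : C) : 1 < `|lam| ->
  (forall k, `|lam ^+ k * c| <= B) -> c = 0.
Proof.
move=> l1 cB; apply/eqP; apply: contraT => c0.
have B0 : 0 <= B by apply: le_trans (cB 0%N); rewrite normr_ge0.
have c1 : 0 < `|c| by rewrite normr_gt0.
have [k hk] := pow_unbounded l1 (divr_ge0 B0 (ltW c1)).
have := cB k; rewrite normrM normrX -ler_pdivlMr // => h.
by have := lt_le_trans hk h; rewrite ltxx.
Qed.

Definition bounded p q (f : nat -> 'M[C]_(p, q)) : Prop :=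
  exists B, forall k i j, `|f k i j| <= B.

Lemma bounded_const p q (A : 'M[C]_(p, q)) : bounded (fun=> A).
Proof.
exists (\sum_i \sum_j `|A i j|) => _ i j.
rewrite (bigD1 i) //= (bigD1 j) //= -addrA lerDl addr_ge0 ?sumr_ge0 // => k _.
by rewrite sumr_ge0.
Qed.

Lemma boundedD p q (f g : nat -> 'M[C]_(p, q)) :
  bounded f -> bounded g -> bounded (fun k => f k + g k).
Proof.
move=> [A fA] [B gB]; exists (A + B) => k i j.
by rewrite mxE (le_trans (ler_normD _ _)) // lerD.
Qed.

Lemma boundedM p q r (f : nat -> 'M[C]_(p, q)) (g : nat -> 'M[C]_(q, r)) :
  bounded f -> bounded g -> bounded (fun k => f k *m g k).
Proof.
move=> [A fA] [B gB]; exists (\sum_(i < q) A * B) => k i j.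
rewrite mxE (le_trans (ler_norm_sum _ _ _)) // ler_sum // => l _.
by rewrite normrM ler_pM.
Qed.

Lemma bounded_ext p q (f g : nat -> 'M[C]_(p, q)) :
  (forall k, f k = g k) -> bounded g -> bounded f.
Proof. by move=> fg [B gB]; exists B => k i j; rewrite fg. Qed.

Lemma bounded_trace p (f : nat -> 'M[C]_p) : bounded f ->
  exists B, forall k, `|\tr (f k)| <= B.
Proof.
move=> [B fB]; exists (\sum_(i < p) B) => k.
by rewrite (le_trans (ler_norm_sum _ _ _)) // ler_sum.
Qed.

Lemma realE (x : C) : x \is Num.real -> x^* = x.
Proof. by move/CrealP. Qed.

(** Subtracting the conjugate expression leaves [lam ^+ k * (a^* - a)] bounded, so the difference
    vanishes. *)
Lemma growth_coef_real (lam a B : C) (b : nat -> C) : 1 < `|lam| -> lam \is Num.real ->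
  (forall k, lam ^+ k * a + b k \is Num.real) -> (forall k, `|b k| <= B) -> a \is Num.real.
Proof.
move=> l1 /realE lr ab bB; apply/CrealP/eqP; rewrite -subr_eq0; apply/eqP.
apply: (@bounded_growth_eq0 lam _ (B + B)) => // k.
have /realE := ab k; rewrite rmorphD rmorphM rmorphXn /= lr => e.
have -> : lam ^+ k * (a^* - a) = b k - (b k)^*.
  apply/eqP; rewrite -subr_eq0; apply/eqP.
  transitivity (lam ^+ k * a^* + (b k)^* - (lam ^+ k * a + b k)); first by ring.
  by rewrite e subrr.
by rewrite (le_trans (ler_normB _ _)) // norm_conjC lerD.
Qed.

(** The real sequence [t k = lam ^+ k + b k] satisfies [t k.+1 = lam * t k] up to a bounded error.
    Conjugating gives the same with [lam^*], so [(lam^* - lam) * t k] is bounded although [t k] is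
    not. *)
Lemma growth_ratio_real (lam B : C) (b : nat -> C) : 1 < `|lam| ->
  (forall k, lam ^+ k + b k \is Num.real) -> (forall k, `|b k| <= B) -> lam \is Num.real.
Proof.
move=> l1 tr bB; apply/CrealP/eqP; rewrite -subr_eq0; apply/eqP.
set d := lam^* - lam.
apply: (@bounded_growth_eq0 lam _ (`|d| * B + ((B + `|lam| * B) + (B + `|lam| * B)))) => // k.
have /realE e0 := tr k; have /realE := tr k.+1.
set t := lam ^+ k + b k in e0 *.
pose s j := b j.+1 - lam * b j.
have sB j : `|s j| <= B + `|lam| * B.
  by rewrite (le_trans (ler_normB _ _)) // normrM lerD // ler_wpM2l.
have -> : lam ^+ k.+1 + b k.+1 = lam * t + s k by rewrite /s /t exprS; ring.
rewrite rmorphD rmorphM /= e0 => e1.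
have -> : lam ^+ k * d = - (d * b k) + (s k - (s k)^*).
  have -> : lam ^+ k = t - b k by rewrite /t addrK.
  apply/eqP; rewrite -subr_eq0; apply/eqP.
  transitivity (lam^* * t + (s k)^* - (lam * t + s k)); first by rewrite /d; ring.
  by rewrite e1 subrr.
rewrite (le_trans (ler_normD _ _)) // lerD ?normrN ?normrM ?ler_wpM2l //.
by rewrite (le_trans (ler_normB _ _)) // norm_conjC lerD.
Qed.
End Growth.

(** * Asymptotics of loxodromic powers and the coefficients they detect *)

Section Loxodromic.
Variables (R : realType) (n : nat).
Local Notation C := R[i].
Local Notation J := (Jform R n).
Local Notation V := 'cV[C]_n.+1.
Local Notation M := 'M[C]_n.+1.

(** The multiplier on [u] is forced, since [h] preserves [ip u v = 1]. *)
Definition loxodromic (h : M) (v u : V) (lam : C) : Prop :=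
  [/\ preserves h, h *m v = lam *: v, h *m u = lam^*^-1 *: u, 1 < `|lam| &
      hyperbolic_pair v u].

Lemma gt1_neq0 (lam : C) : 1 < `|lam| -> lam != 0.
Proof. by apply: contraTneq => ->; rewrite normr0 ltr10. Qed.

Lemma loxodromicV h v u lam :
  loxodromic h v u lam -> loxodromic (invmx h) u v lam^*.
Proof.
move=> [hp hv hu l1 hyp]; have hU := preserves_unit hp.
have l0 := gt1_neq0 l1.
split; rewrite ?conjCK ?norm_conjC //; last 1 first.
- exact: hyperbolic_pairC.
- exact: preservesV.
- by rewrite -[LHS]scale1r -(@divff _ lam^*) ?conjC_eq0 // -scalerA scalemxAr -hu mulKmx.
- by rewrite -[LHS]scale1r -(@mulVf _ lam) // -scalerA scalemxAr -hv mulKmx.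
Qed.

Lemma preservesX (h : M) k : preserves h -> preserves (h ^+ k).
Proof.
move=> hp; elim: k => [|k IH]; first by rewrite expr0; exact: preserves1.
by rewrite exprS; apply: preservesM.
Qed.

Lemma eigenX (h : M) (x : V) a k : h *m x = a *: x -> h ^+ k *m x = a ^+ k *: x.
Proof.
move=> hx; elim: k => [|k IH]; first by rewrite !expr0 mul1mx scale1r.
by rewrite exprSr -mulmxE -mulmxA hx -scalemxAr IH scalerA -exprS.
Qed.

(** When [ip u v = 1] this is the projection onto [v] along the complement of [u]; the factor [J]
    makes its trace against [g] the coefficient [ip u (g *m v)]. *)
Definition rank1 (v u : V) : M := v *m hadj u *m J.

Lemma rank1E v u x : rank1 v u *m x = ip u x *: v.
Proof. by rewrite /rank1 -!mulmxA (mulmxA (hadj u)) ip_mx mul_mx_scalar. Qed.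

Lemma mul_rank1 (g : M) v u : g *m rank1 v u = rank1 (g *m v) u.
Proof. by rewrite /rank1 !mulmxA. Qed.

Lemma rank1Zl a v u : rank1 (a *: v) u = a *: rank1 v u.
Proof. by rewrite /rank1 -!scalemxAl. Qed.

Lemma rank1Zr a v u : rank1 v (a *: u) = a^* *: rank1 v u.
Proof. by rewrite /rank1 hadjZ -scalemxAr -scalemxAl. Qed.

Lemma rank1_mul (g : M) v u : preserves g -> rank1 v u *m g = rank1 v (invmx g *m u).
Proof.
move=> gp; rewrite /rank1 hadjM preserves_inv // !hadjM hadjK hadj_Jform.
by rewrite -!mulmxA Jform_involutive mulmx1.
Qed.

Lemma mxtrace_rank1 (g : M) v u : \tr (rank1 v u *m g) = ip u (g *m v).
Proof.
rewrite /rank1 -!mulmxA mxtrace_mulC /ip.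
by rewrite trace_mx11 !mulmxA.
Qed.

(** Along [u] the powers contract, and on the complement of the pair they are isometries of a
    definite form, whose orbits have bounded coordinates by [orth_pair_bound]. *)
Lemma loxodromic_pow_bounded h v u lam : loxodromic h v u lam ->
  bounded (fun k => h ^+ k - lam ^+ k *: rank1 v u).
Proof.
move=> [hp hv hu l1 hyp]; have [vv uu uv] := hyp.
have vu : ip v u = 1 by rewrite ipC uv conjC1.
have l0 := gt1_neq0 l1.
(* The projection onto the complement of [v] and [u]; its columns are the vectors to which the bound
   applies. *)
pose Pi : M := 1%:M - rank1 v u - rank1 u v.
apply: (@bounded_ext _ _ _ _ (fun k => h ^+ k *m Pi + (lam^*^-1) ^+ k *: rank1 u v)).
  move=> k; rewrite /Pi !mulmxBr mulmx1 !mul_rank1 (eigenX _ hv) (eigenX _ hu) !rank1Zl.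
  by rewrite subrK.
apply: boundedD; last first.
  have [B hB] := bounded_const (rank1 u v); exists B => k i j.
  rewrite mxE normrM normrX normfV norm_conjC -[leRHS]mul1r.
  apply: ler_pM; rewrite ?exprn_ge0 ?invr_ge0 //; last exact: (hB 0%N).
  by rewrite exprn_ile1 ?invr_ge0 // invf_le1 ?(lt_trans ltr01) // ltW.
have [K [K0 hK]] := orth_pair_bound hyp.
exists (\sum_(j < n.+1) K * (ip (col j Pi) (col j Pi) + 1)) => k i j.
have PiE : col j Pi = Pi *m delta_mx j 0 by rewrite colE.
have pv : ip v (col j Pi) = 0.
  by rewrite PiE !mulmxBl mul1mx !rank1E !ip_lin vv vu; ring.
have pu : ip u (col j Pi) = 0.
  by rewrite PiE !mulmxBl mul1mx !rank1E !ip_lin uu uv; ring.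
have cE : (h ^+ k *m Pi) i j = (h ^+ k *m col j Pi) i 0.
  by rewrite PiE mulmxA -colE [RHS]mxE.
have hkp := preservesX k hp.
have lk0 : lam ^+ k != 0 by rewrite expf_neq0.
rewrite cE; apply: le_trans (hK _ _ _ i) _.
- have := preserves_ip v (col j Pi) hkp; rewrite (eigenX _ hv) ip_lin pv => /eqP.
  by rewrite mulf_eq0 conjC_eq0 (negPf lk0) => /eqP.
- have := preserves_ip u (col j Pi) hkp; rewrite (eigenX _ hu) ip_lin pu => /eqP.
  by rewrite mulf_eq0 conjC_eq0 expf_eq0 invr_eq0 conjC_eq0 (negPf l0) andbF => /eqP.
- rewrite preserves_ip // (bigD1 j) //= lerDl sumr_ge0 // => j' _.
  have pv' : ip v (col j' Pi) = 0.
    by rewrite colE !mulmxBl mul1mx !rank1E !ip_lin vv vu; ring.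
  by rewrite mulr_ge0 // addr_ge0 // (null_orth_ge0 vv) // (hyperbolic_pair_neq0 hyp).
Qed.

Lemma loxodromic_real h v u lam : loxodromic h v u lam ->
  (forall k, \tr (h ^+ k) \is Num.real) -> lam \is Num.real.
Proof.
move=> hl tr; have [_ _ _ l1 [_ _ uv]] := hl.
have [B hB] := bounded_trace (loxodromic_pow_bounded hl).
apply: growth_ratio_real l1 _ hB => k.
rewrite linearB /= linearZ /= -[rank1 _ _]mulmx1 mxtrace_rank1 mul1mx uv mulr1.
by rewrite addrC subrK.
Qed.

Lemma loxodromic_coef_real h v u lam g : loxodromic h v u lam -> lam \is Num.real ->
  (forall k, \tr (h ^+ k *m g) \is Num.real) -> ip u (g *m v) \is Num.real.
Proof.
move=> hl lr tr; have [_ _ _ l1 _] := hl.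
have [B hB] := bounded_trace (boundedM (loxodromic_pow_bounded hl) (bounded_const g)).
apply: growth_coef_real l1 lr _ hB => k.
by rewrite mulmxBl -scalemxAl linearB /= linearZ /= mxtrace_rank1 addrC subrK.
Qed.

(** The product is the coefficient of [lam ^+ k] in [ip x (g *m h ^+ k *m g' *m y)]. *)
Lemma loxodromic_coef2_real h v u lam (g g' : M) (x y : V) : loxodromic h v u lam -> lam \is Num.real ->
  (forall k, ip x (g *m h ^+ k *m g' *m y) \is Num.real) ->
  ip x (g *m v) * ip u (g' *m y) \is Num.real.
Proof.
move=> hl lr xy; have [_ _ _ l1 _] := hl.
have [B hB] := boundedM (bounded_const (hadj x *m J *m g))
  (boundedM (loxodromic_pow_bounded hl) (bounded_const (g' *m y))).
apply: (growth_coef_real l1 lr _ (fun k => hB k 0 0)) => k.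
have -> // : forall A : M, (hadj x *m J *m g *m (A *m (g' *m y))) 0 0 = ip x (g *m A *m g' *m y).
  by move=> A; rewrite /ip !mulmxA.
rewrite mulmxBr !mulmxBl -scalemxAr -!scalemxAl mul_rank1 -(mulmxA (rank1 _ _)) rank1E !ip_lin.
have -> // : forall a b c d : C, a * (b * c) + (d - a * (c * b)) = d.
by move=> a b c d; ring.
Qed.
End Loxodromic.

(** * Discreteness *)
Section Pigeonhole.
Variable R : realType.
Local Notation C := R[i].

(** Rounding each coordinate to a cell of width [d] sends infinitely many points to finitely many
    cells. *)
Lemma real_pigeonhole (I : finType) (f : nat -> I -> R) (B d : R) :
  0 < d -> (forall k i, `|f k i| <= B) ->
  exists k l, (k < l)%N /\ forall i, `|f k i - f l i| < d.
Proof.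
move=> d0 fB; pose c k i := Num.truncn ((f k i + B) / d).
have c0 k i : 0 <= (f k i + B) / d.
  apply: divr_ge0 (ltW d0); rewrite -lerBlDr sub0r; by have := fB k i; rewrite ler_norml => /andP[].
pose K := Num.truncn ((B + B) / d).
have cK k i : (c k i < K.+1)%N.
  rewrite ltnS; apply: le_truncn; rewrite ler_pM2r ?invr_gt0 // lerD2r.
  by have := fB k i; rewrite ler_norml => /andP[].
pose F (k : 'I_(#|{ffun I -> 'I_K.+1}|.+1)) : {ffun I -> 'I_K.+1} := [ffun i => Ordinal (cK k i)].
have /injectivePn[k [l kl Fkl]] : ~~ injectiveb F.
  by apply/injectiveP => /leq_card; rewrite card_ord ltnn.
wlog lt_kl : k l kl Fkl / (k < l)%N.
  move=> H; case: (ltngtP k l) => [lkl|llk|e]; first exact: H lkl.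
    by apply: H llk; rewrite // eq_sym.
  by move/val_inj: e kl => ->; rewrite eqxx.
exists k, l; split=> // i.
have /(congr1 val) /= ckl : F k i = F l i by rewrite Fkl.
rewrite !ffunE /= in ckl.
have /andP[k1 k2] := truncn_itv (c0 k i); have /andP[l1 l2] := truncn_itv (c0 l i).
rewrite -/(c k i) ckl in k1 k2; rewrite -/(c l i) in l1 l2.
have : `|(f k i + B) / d - (f l i + B) / d| < 1.
  move: l1 l2 k1 k2; rewrite -natr1; move: (_%:R) ((f k i + B) / d) ((f l i + B) / d) => a x y *.
  by rewrite ltr_norml; apply/andP; split; lra.
rewrite -mulrBl normrM [`|d^-1|]gtr0_norm ?invr_gt0 // ltr_pdivrMr // mul1r.
by rewrite opprD addrACA subrr addr0.
Qed.

Lemma normc_real (r : R) : `|r%:C%C| = `|r|%:C%C :> C.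
Proof. by rewrite normc_def /= expr0n addr0 sqrtr_sqr. Qed.

Lemma bounded_pigeonhole p q (f : nat -> 'M[C]_(p, q)) (d : C) : 0 < d -> bounded f ->
  exists k l, (k < l)%N /\ forall i j, `|f k i j - f l i j| < d.
Proof.
move=> d0 [B fB].
have dE : d = (complex.Re d)%:C%C by rewrite RRe_real // gtr0_real.
have r0 : 0 < complex.Re d by rewrite -ltcR -dE.
(* The boolean selects the real part or, as [Re (z * i)], minus the imaginary part; closeness within
   half of [d] in both gives closeness within [d]. *)
pose g k (x : 'I_p * 'I_q * bool) := let z := f k x.1.1 x.1.2 in
  if x.2 then complex.Re z else complex.Re (z * 'i%C).
have gB k x : `|g k x| <= complex.Re B.
  rewrite /g; case: x => [[i j] b] /=.
  have fb := fB k i j.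
  have BE : B = (complex.Re B)%:C%C by rewrite RRe_real // ger0_real // (le_trans _ fb).
  rewrite -lecR -BE; apply: le_trans fb; case: b; first exact: normc_ge_Re.
  apply: le_trans (normc_ge_Re _) _; rewrite normrM [X in _ * X](_ : _ = 1) ?mulr1 //.
  by rewrite normc_def /= expr0n expr1n add0r sqrtr1.
have [k [l [kl gkl]]] := real_pigeonhole (divr_gt0 r0 (ltr0Sn _ 1)) gB.
exists k, l; split=> // i j.
have := gkl (i, j, true); have := gkl (i, j, false); rewrite /g /=.
have ReB (x y : C) : complex.Re x - complex.Re y = complex.Re (x - y) by case: x y => [a b] [a' b'].
rewrite !ReB -mulrBl ReiNIm normrN; move: (f k i j - f l i j) => z h1 h2.
rewrite [z]complexE dE; apply: le_lt_trans (ler_normD _ _) _.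
rewrite normrM [X in _ + X * _](_ : _ = 1) ?mul1r; last first.
  by rewrite normc_def /= expr0n expr1n add0r sqrtr1.
rewrite !normc_real -rmorphD ltcR [ltRHS](splitr (complex.Re d)); exact: ltrD.
Qed.
End Pigeonhole.

(** * Discrete groups: bounded sequences repeat *)

Section Discrete.
Variables (R : realType) (n : nat).
Local Notation C := R[i].
Local Notation J := (Jform R n).
Local Notation V := 'cV[C]_n.+1.
Local Notation M := 'M[C]_n.+1.
Variable Gam : M -> Prop.
Hypothesis sub : is_subgroup_SU_n1 Gam.

Let Gam_mul g h : Gam g -> Gam h -> Gam (g *m h).
Proof. by case: sub => _ [H _]; exact: H. Qed.
Let Gam_inv g : Gam g -> Gam (invmx g).
Proof. by case: sub => _ [_ [H _]]; exact: H. Qed.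
Let Gam_1 : Gam 1%:M.
Proof. by case: sub. Qed.
Lemma Gam_preserves g : Gam g -> preserves g.
Proof. by case: sub => _ [_ [_ H]] /H[]. Qed.
Lemma Gam_exp g k : Gam g -> Gam (g ^+ k).
Proof. by move=> Gg; elim: k => [|k IH]; rewrite ?expr0 // exprS; apply: Gam_mul. Qed.

(** Inverses of form-preserving matrices are bounded along with the matrices, so two close terms
    have a quotient close to 1, and isolation of 1 makes that quotient trivial. *)
Lemma discrete_bounded_repeat (f : nat -> M) : discrete_set Gam ->
  (forall k, Gam (f k)) -> bounded f -> exists k l, (k < l)%N /\ f k = f l.
Proof.
move=> disc Gf fb; have [eps [e0 heps]] := disc _ Gam_1.
have [B hB] : bounded (fun k => invmx (f k)).
  apply: (@bounded_ext _ _ _ _ (fun k => J *m hadj (f k) *m J)).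
    by move=> k; rewrite preserves_inv //; apply: Gam_preserves.
  apply: boundedM (bounded_const _); apply: boundedM (bounded_const _) _.
  by case: fb => B hB; exists B => k i j; rewrite hadjE norm_conjC.
have B0 : 0 <= B by apply: le_trans (hB 0%N 0 0).
(* Using [B + 1] instead of [B] keeps the divisor positive and the final estimate strict. *)
pose s : C := \sum_(i < n.+1) (B + 1).
have s0 : 0 < s.
  by rewrite /s (bigD1 ord0) //= ltr_pwDl ?ltr_wpDl // sumr_ge0 // => i _; rewrite addr_ge0.
have [k [l [kl fkl]]] := bounded_pigeonhole (divr_gt0 e0 s0) fb.
exists k, l; split=> //; apply/eqP; apply: contraT => /eqP ne.
have Uk : f k \in unitmx by apply/preserves_unit/Gam_preserves.
have Gkl : Gam (invmx (f k) *m f l) by apply: Gam_mul (Gf l); apply: Gam_inv.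
have [|i [j]] := heps _ Gkl.
  by move=> e; apply: ne; rewrite -[LHS]mulmx1 -e mulKVmx.
have -> : (invmx (f k) *m f l) i j - (1%:M : M) i j = \sum_m invmx (f k) i m * (f l m j - f k m j).
  rewrite -(mulVmx Uk) !mxE -sumrB; apply: eq_bigr => m _; by rewrite mulrBr.
move=> /le_lt_trans H; suff: eps < eps by rewrite ltxx.
apply: H; apply: le_lt_trans (ler_norm_sum _ _ _) _.
rewrite -[ltRHS](divfK (lt0r_neq0 s0)) mulrC /s mulr_suml.
apply: ltr_sum; first by apply/hasP; exists ord0; rewrite ?mem_index_enum.
move=> m _; rewrite normrM distrC.
apply: le_lt_trans (_ : B * (eps / s) < _); first by rewrite ler_pM // ltW.
by rewrite ltr_pM2r ?divr_gt0 // ltrDl.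
Qed.

Lemma rank10l (u : V) : rank1 0 u = 0.
Proof. by rewrite /rank1 !mul0mx. Qed.

(** Meant for [A] and [B] the powers [h^-k] and [h^k], with [b = lam ^+ k]: both outer factors of
    the last product are then bounded. The cross terms stay bounded because [g] keeps the line of
    [v], where [A] contracts by exactly [b]; the term of size [|b|^2] vanishes because [v] is
    null. *)
Lemma rank1_sandwich (A B g : M) (v u : V) (b chi : C) :
  preserves g -> preserves B -> ip v v = 0 -> b != 0 ->
  g *m v = chi *: v -> invmx g *m v = chi^-1 *: v ->
  A *m v = b^-1 *: v -> invmx B *m v = b^-1 *: v ->
  A *m g *m B = chi *: rank1 v u + (chi^-1)^* *: rank1 u v
    + (A - b^* *: rank1 u v) *m (g *m (B - b *: rank1 v u)).
Proof.
move=> gp Bp vv b0 gv gv' Av Bv.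
have bb : b^* * (b^-1)^* = 1 by rewrite -rmorphM /= mulfV // conjC1.
have coefQ : b^* * (chi^-1)^* * (b^-1)^* = (chi^-1)^* by rewrite mulrAC bb mul1r.
have bcb : b * (chi / b) = chi by rewrite mulrCA mulfV // mulr1.
have AgP : A *m g *m rank1 v u = (chi / b) *: rank1 v u.
  by rewrite -mulmxA !mul_rank1 gv -scalemxAr Av scalerA rank1Zl.
have Qg : rank1 u v *m g = (chi^-1)^* *: rank1 u v.
  rewrite (rank1_mul _ _ gp) gv'; exact: rank1Zr.
have QB : rank1 u v *m B = (b^-1)^* *: rank1 u v.
  rewrite (rank1_mul _ _ Bp) Bv; exact: rank1Zr.
have QP : rank1 u v *m rank1 v u = 0 by rewrite mul_rank1 rank1E vv scale0r rank10l.
have E1 : (A - b^* *: rank1 u v) *m g = A *m g - (b^* * (chi^-1)^*) *: rank1 u v.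
  rewrite mulmxBl -scalemxAl Qg scalerA; reflexivity.
have E2 : (A *m g - (b^* * (chi^-1)^*) *: rank1 u v) *m (B - b *: rank1 v u) =
    A *m g *m B - chi *: rank1 v u - (chi^-1)^* *: rank1 u v.
  rewrite mulmxBr 2!mulmxBl -!scalemxAr -!scalemxAl AgP QB QP !scaler0 subr0.
  rewrite !scalerA bcb coefQ; exact: addrAC.
have split3 (X P Q : M) : X = P + Q + (X - P - Q) by rewrite -(addrA X) -opprD [RHS]addrC subrK.
rewrite [X in _ = _ + X]mulmxA E1 E2; exact: split3.
Qed.

(* Conjugating by high powers of [h] contracts the part of [g] that moves
   [u], so these conjugates stay bounded, and discreteness makes two of them equal. *)
Lemma discrete_fix_repelling h v u lam g chi : discrete_set Gam -> Gam h ->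
  loxodromic h v u lam -> Gam g -> g *m v = chi *: v -> exists a, g *m u = a *: u.
Proof.
move=> disc Gh lox Gg gv; have lox' := loxodromicV lox.
have [hp hv hu l1 hyp] := lox; have [hp' hv' hu' _ _] := lox'.
rewrite conjCK in hu'.
have [vv uu uv] := hyp; have gp := Gam_preserves Gg; have gU := preserves_unit gp.
have v0 := hyperbolic_pair_neq0 hyp; have u0 := hyperbolic_pair_neq0 (hyperbolic_pairC hyp).
have l0 := gt1_neq0 l1.
have chi0 : chi != 0.
  by apply: contraNneq v0 => c0; rewrite -[v](mulKmx gU) gv c0 scale0r mulmx0.
have gv' : invmx g *m v = chi^-1 *: v.
  by rewrite -[v in LHS]scale1r -(@mulVf _ chi) // -scalerA -gv -scalemxAr mulKmx.
pose f k : M := invmx h ^+ k *m g *m h ^+ k.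
have fE k : f k = chi *: rank1 v u + (chi^-1)^* *: rank1 u v
    + (invmx h ^+ k - lam^* ^+ k *: rank1 u v) *m (g *m (h ^+ k - lam ^+ k *: rank1 v u)).
  have lk0 : lam ^+ k != 0 by rewrite expf_neq0.
  have hkp := preservesX k hp.
  have hkv : invmx (h ^+ k) *m v = (lam ^+ k)^-1 *: v.
    rewrite -[v in LHS]scale1r -(mulVf lk0) -scalerA -(eigenX k hv) -scalemxAr.
    rewrite (mulKmx (preserves_unit hkp)); reflexivity.
  have hkv' : invmx h ^+ k *m v = (lam ^+ k)^-1 *: v.
    rewrite (eigenX k hu') exprVn; reflexivity.
  rewrite -rmorphXn; exact: rank1_sandwich.
have fb : bounded f.
  apply: bounded_ext fE _; apply: boundedD (bounded_const _) _.
  apply: boundedM; first exact: loxodromic_pow_bounded lox'.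
  by apply: boundedM (bounded_const g) _; exact: loxodromic_pow_bounded lox.
have Gf k : Gam (f k).
  by apply: Gam_mul; [apply: Gam_mul => // | ]; apply: Gam_exp => //; apply: Gam_inv.
have [k [l [kl fkl]]] := discrete_bounded_repeat disc Gf fb.
(* The pairing of [u] with [f k *m u] decays like [|lam|^(-2k)], so a repetition is possible only if
   [ip u (g *m u) = 0]; null vectors being proportional when orthogonal, [g] then keeps the line of
   [u]. *)
have ipf k' : ip u (f k' *m u) * (`|lam| ^+ k' ^+ 2) = ip u (g *m u).
  have := preserves_ip u (g *m u) (preservesX k' hp').
  rewrite (eigenX k' hv') /f -!mulmxA (eigenX k' hu) -!scalemxAr !ip_lin => <-.
  rewrite rmorphXn /= conjCK -exprM mulnC exprM normCK exprMn exprVn.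
  by field; rewrite !expf_neq0 // conjC_eq0.
have : ip u (g *m u) = 0.
  have := ipf l; rewrite -fkl -(ipf k) => /eqP; rewrite -subr_eq0 -mulrBr mulf_eq0 => /orP[/eqP->|].
    by rewrite mul0r.
  rewrite subr_eq0 eqrXn2 ?exprn_ge0 // => /eqP e.
  have := ltr_eXn2l l1 k l; rewrite kl -e ltxx => //.
move=> /(null_orth_prop uu u0); apply; by rewrite preserves_ip.
Qed.
End Discrete.

(** * Limit points *)
Section LimitSet.
Variables (R : realType) (n : nat).
Local Notation C := R[i].
Local Notation J := (Jform R n).
Local Notation V := 'cV[C]_n.+1.
Local Notation M := 'M[C]_n.+1.

Lemma small_le0 (a K : C) : 0 <= a -> 0 <= K ->
  (forall eps, 0 < eps -> eps <= 1 -> a <= K * eps) -> a = 0.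
Proof.
move=> a0 K0 h; apply/eqP; apply: contraT => an0.
have ap : 0 < a by rewrite lt0r an0.
have s0 : 0 < a + K + 1 by rewrite ltr_wpDl ?addr_ge0.
have e1 : a / (a + K + 1) <= 1 by rewrite ler_pdivrMr // mul1r -addrA lerDl addr_ge0.
have := h _ (divr_gt0 ap s0) e1; rewrite mulrA ler_pdivlMr // mulrC ler_pM2r //.
have : K < a + K + 1 by rewrite ltr_pwDr // lerDr.
by move=> /lt_le_trans H /H; rewrite ltxx.
Qed.

Lemma col_sub (x y : V) i : (x - y) i 0 = x i 0 - y i 0.
Proof. by rewrite !mxE. Qed.

Lemma col_subZ (x y : V) c i : (x - c *: y) i 0 = x i 0 - c * y i 0.
Proof. by rewrite !mxE. Qed.

Definition origin : V := delta_mx ord_max 0.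

(* The image of the base point under [g], as a vector with last coordinate 1. *)
Definition dir (g : M) : V := (g ord_max ord_max)^-1 *: (g *m origin).

Definition boundary_pt (xi : 'rV[C]_n) : V :=
  \col_i (if unlift ord_max i is Some j then xi 0 j else 1).

Lemma ip_origin x : ip origin x = - x ord_max 0.
Proof.
rewrite ipE big1 => [|i _]; first by rewrite mxE !eqxx /= conjC1 mul1r add0r.
by rewrite mxE eq_sym (negPf (neq_lift _ _)) /= conjC0 mul0r.
Qed.

Lemma mul_origin (g : M) i : (g *m origin) i 0 = g i ord_max.
Proof. by rewrite -colE mxE. Qed.

Lemma ip_norm_le (x y : V) : `|ip x y| <= \sum_i `|x i 0| * `|y i 0|.
Proof.
rewrite /ip mul_mx_diag mxE (le_trans (ler_norm_sum _ _ _)) // ler_sum // => i _.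
by rewrite !mxE !normrM norm_conjC; case: ifP => _; rewrite ?normrN normr1 mulr1.
Qed.

Lemma ip_bound (x y : V) a b : (forall i, `|x i 0| <= a) -> (forall i, `|y i 0| <= b) ->
  `|ip x y| <= n.+1%:R * (a * b).
Proof.
move=> xa yb; apply: le_trans (ip_norm_le x y) _.
apply: le_trans (_ : \sum_(i < n.+1) a * b <= _).
  by apply: ler_sum => i _; rewrite ler_pM.
by rewrite sumr_const card_ord mulr_natl.
Qed.

Lemma corner_norm (g : M) : preserves g -> 1 <= `|g ord_max ord_max|.
Proof.
move=> gp; have := preserves_ip origin origin gp.
rewrite ip_origin mxE !eqxx /= ipxx mul_origin => /eqP; rewrite subr_eq addrC => /eqP e.
have : 1 <= `|g ord_max ord_max| ^+ 2.
  have := spatial_ge0 (g *m origin); rewrite e subr_ge0 //.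
by rewrite -{1}(expr1n _ 2) ler_pXn2r // ?nnegrE.
Qed.

Lemma corner_neq0 (g : M) : preserves g -> g ord_max ord_max != 0.
Proof. by move/corner_norm => h; rewrite -normr_gt0 (lt_le_trans ltr01). Qed.

Lemma dir_last g : preserves g -> dir g ord_max 0 = 1.
Proof. by move=> gp; rewrite mxE mul_origin mulVf // corner_neq0. Qed.

Lemma ip_dir g : preserves g -> ip (dir g) (dir g) = - `|g ord_max ord_max|^-1 ^+ 2.
Proof.
move=> gp; rewrite !ip_lin preserves_ip // ip_origin mxE !eqxx /= mulrA.
rewrite [X in _ = - X](_ : _ = `|(g ord_max ord_max)^-1| ^+ 2); last by rewrite normfV.
by rewrite normCK mulrN1 mulrC.
Qed.

Lemma ball_coord (x : V) i : x ord_max 0 = 1 -> ip x x <= 0 -> `|x i 0| <= 1.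
Proof.
move=> x1; rewrite ipxx x1 normr1 expr1n subr_le0 => sx.
rewrite -(@ler_pXn2r _ 2) ?nnegrE // expr1n.
case: (unliftP ord_max i) => [j|] ->; last by rewrite x1 normr1 expr1n.
apply: le_trans sx; rewrite /spatial (bigD1 j) //= lerDl sumr_ge0 // => k _; exact: exprn_ge0.
Qed.

Lemma dir_le1 g i : preserves g -> `|dir g i 0| <= 1.
Proof.
move=> gp; apply: ball_coord; first exact: dir_last.
by rewrite ip_dir // oppr_le0 exprn_ge0 // invr_ge0.
Qed.

(** The Schur complement of the corner entry: with [c] the last index, its [i j] entry is
    [g i j - g i c * g c j / g c c]. The plus sign appears because pairing with [origin] gives minus
    the last coordinate. *)
Definition residue (g : M) : M :=
  g + g ord_max ord_max *: rank1 (dir g) (dir (invmx g)).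

(** Column [j] is the image under [g] of [delta_mx j 0 - c *: origin], with [c] chosen to kill the
    last coordinate of the image. Its Euclidean square norm is thus the form of that vector, which
    is [1 - |c|^2], or 0 for the last column. *)
Lemma residue_bound g i j : preserves g -> `|residue g i j| <= 1.
Proof.
move=> gp; have d0 := corner_neq0 gp.
have gi : (invmx g) ord_max ord_max = (g ord_max ord_max)^*.
  rewrite -(mul_origin (invmx g)) -[LHS]opprK -ip_origin ipC.
  by rewrite (preserves_ipl _ _ (preservesV gp)) invmxK ip_origin mul_origin rmorphN opprK.
pose c := g ord_max j / g ord_max ord_max.
have rE : residue g *m delta_mx j 0 = g *m (delta_mx j 0 - c *: origin).
  rewrite mulmxDl -scalemxAl rank1E /dir !ip_lin gi.
  rewrite (preserves_ipl _ _ (preservesV gp)) invmxK ip_origin -colE mxE fmorphV /= conjCK.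
  rewrite mulmxBr -scalemxAr !scalerA -colE; congr (_ + _).
  by rewrite -scaleNr; congr (_ *: _); rewrite /c; field.
have r0 : (residue g *m delta_mx j 0 : V) ord_max 0 = 0.
  rewrite rE mulmxBr -scalemxAr -colE col_subZ mul_origin mxE.
  by rewrite /c divfK // subrr.
have -> : residue g i j = (residue g *m delta_mx j 0 : V) i 0 by rewrite -colE [RHS]mxE.
rewrite -(@ler_pXn2r _ 2) ?nnegrE // expr1n; apply: le_trans (spatial_le i r0) _.
have -> : spatial (residue g *m delta_mx j 0) = ip (delta_mx j 0 - c *: origin) (delta_mx j 0 - c *: origin).
  by rewrite -(preserves_ip _ _ gp) -rE ipxx r0 normr0 expr0n subr0.
have [je|jn] := eqVneq j ord_max.
  by rewrite /c je -/origin divff // scale1r subrr ip0l ler01.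
rewrite !ip_lin (ipC origin (delta_mx j 0)) !ip_origin.
have -> : (delta_mx j 0 : V) ord_max 0 = 0 by rewrite mxE eq_sym (negPf jn).
have -> : ip (delta_mx j 0 : V) (delta_mx j 0) = 1.
  rewrite ipxx [X in _ - `|X| ^+ 2]mxE eq_sym (negPf jn) normr0 expr0n subr0.
  case: (unliftP ord_max j) => [k jk|e]; last by rewrite e eqxx in jn.
  rewrite /spatial (bigD1 k) //= big1 => [|l lk]; first by rewrite mxE jk !eqxx normr1 expr1n addr0.
  by rewrite mxE jk (inj_eq lift_inj) (negPf lk) normr0 expr0n.
have -> : (origin : V) ord_max 0 = 1 by rewrite mxE !eqxx.
rewrite oppr0 conjC0 [X in X <= _](_ : _ = 1 - `|c| ^+ 2) ?gerBl ?exprn_ge0 //.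
by rewrite normCK; ring.
Qed.
End LimitSet.

(** * Approximation of limit points and elementary groups *)

Section Accumulation.
Variables (R : realType) (n : nat).
Local Notation C := R[i].
Local Notation J := (Jform R n).
Local Notation V := 'cV[C]_n.+1.
Local Notation M := 'M[C]_n.+1.

Lemma boundary_pt_last (xi : 'rV[C]_n) : boundary_pt xi ord_max 0 = 1 :> C.
Proof. by rewrite mxE unlift_none. Qed.

Lemma boundary_pt_lift (xi : 'rV[C]_n) i : boundary_pt xi (lift ord_max i) 0 = xi 0 i :> C.
Proof. by rewrite mxE liftK. Qed.

Lemma boundary_pt_inj : injective (@boundary_pt R n).
Proof.
move=> xi xi' e; apply/rowP=> i.
by rewrite -[LHS]boundary_pt_lift e boundary_pt_lift.
Qed.

Lemma boundary_pt_null (xi : 'rV[C]_n) : in_sphere xi -> ip (boundary_pt xi) (boundary_pt xi) = 0.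
Proof.
move=> xs; rewrite ipxx boundary_pt_last normr1 expr1n /spatial.
under eq_bigr do rewrite boundary_pt_lift.
by rewrite [X in X - 1]xs subrr.
Qed.

Lemma boundary_pt_neq0 (xi : 'rV[C]_n) : boundary_pt xi != 0 :> V.
Proof.
by apply/eqP => /matrixP /(_ ord_max 0) /eqP; rewrite boundary_pt_last mxE oner_eq0.
Qed.

Lemma boundary_pt_orth (xi xi' : 'rV[C]_n) : in_sphere xi -> in_sphere xi' ->
  ip (boundary_pt xi) (boundary_pt xi') = 0 -> xi = xi'.
Proof.
move=> xs xs' o; apply: boundary_pt_inj.
have [t e] := null_orth_prop (boundary_pt_null xs) (boundary_pt_neq0 xi) o (boundary_pt_null xs').
have := boundary_pt_last xi'; rewrite e [LHS]mxE boundary_pt_last mulr1 => ->.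
by rewrite scale1r.
Qed.

Lemma orbit0_dir (g : M) i : orbit0 g 0 i = dir g (lift ord_max i) 0.
Proof.
rewrite [LHS]mxE [RHS]mxE mulrC mul_origin; congr (_ * _).
by congr (g _ _); apply: val_inj; rewrite /= /bump leqNgt ltn_ord.
Qed.

Lemma sqr_dist (x y : C) (e : C) : `|x| <= 1 -> `|y| <= 1 -> `|x - y| <= e ->
  `|y| ^+ 2 - `|x| ^+ 2 <= 2%:R * e.
Proof.
move=> x1 y1 xy; have e0 : 0 <= e by apply: le_trans xy.
have yx : `|y| - `|x| <= e.
  by rewrite lerBlDr -[y in leLHS](subrK x) (le_trans (ler_normD _ _)) // lerD2r distrC.
rewrite subr_sqr mulrC; apply: le_trans (_ : (`|y| + `|x|) * e <= _).
  by rewrite ler_wpM2l // addr_ge0.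
by rewrite ler_wpM2r // -[2%:R]/(1 + 1) lerD.
Qed.

Variable Gam : M -> Prop.
Hypothesis Gp : forall g, Gam g -> preserves g.

Lemma limit_set_approx xi eps : limit_set Gam xi -> 0 < eps -> eps <= 1 ->
  exists g, [/\ Gam g, forall i, `|dir g i 0 - boundary_pt xi i 0| <= eps &
                `|g ord_max ord_max|^-1 <= eps].
Proof.
move=> [xs xl] e0 e1.
have N0 : 0 < (n.*2).+1%:R :> C by rewrite ltr0Sn.
(* By [ip_dir], the squared inverse of the corner entry is the defect of [dir g] from the unit
   sphere, at most [2 * n * del]; the extra 1 keeps the denominator positive when [n = 0]. *)
pose del := eps ^+ 2 / (n.*2).+1%:R.
have d0 : 0 < del by rewrite divr_gt0 // exprn_gt0.
have de : del <= eps.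
  rewrite ler_pdivrMr // expr2 ler_wpM2l ?(ltW e0) // (le_trans e1) //.
  by rewrite ler1n.
have [g [Gg gl]] := xl del d0; have gp := Gp Gg.
have dd i : `|dir g i 0 - boundary_pt xi i 0| <= del.
  case: (unliftP ord_max i) => [j|] ->.
    by rewrite boundary_pt_lift -orbit0_dir ltW.
  by rewrite boundary_pt_last dir_last // subrr normr0 ltW.
exists g; split=> [||]; [by []|by move=> i; apply: le_trans de|].
have z1 i : `|boundary_pt xi i 0| <= 1.
  by apply: ball_coord; rewrite ?boundary_pt_last ?boundary_pt_null.
rewrite -(@ler_pXn2r _ 2) ?nnegrE ?invr_ge0 ?(ltW e0) //.
rewrite -[leLHS]opprK -ip_dir // -[leLHS]add0r -(boundary_pt_null xs).
rewrite !ipxx boundary_pt_last dir_last // opprD opprK addrACA [- _ + _]addrC subrr addr0.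
rewrite /spatial -sumrB; apply: le_trans (_ : \sum_(i < n) 2%:R * del <= _).
  apply: ler_sum => i _; apply: sqr_dist; rewrite ?z1 ?dd //.
  exact: dir_le1.
rewrite sumr_const card_ord -[leLHS]mulr_natl mulrA -natrM muln2 /del mulrCA ler_piMr ?exprn_ge0 ?ltW //.
by rewrite ltr_pdivrMr // mul1r ltr_nat.
Qed.

Lemma ip_lipschitz (v x y : V) eps : (forall i, `|x i 0 - y i 0| <= eps) ->
  `|ip v x - ip v y| <= (\sum_i `|v i 0|) * eps.
Proof.
move=> xy; rewrite -ipNr -ipDr (le_trans (ip_norm_le _ _)) // mulr_suml ler_sum // => i _.
by rewrite ler_wpM2l // !mxE.
Qed.

(* The product [|<v, g o>| * |<u, g o>|] stays constant while [|g_nn|] grows,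
   so every limit point is orthogonal to [v] or to [u]. *)
Lemma invariant_pair_limit (v u : V) xi :
  (forall g, Gam g -> `|ip v (g *m origin _ _)| * `|ip u (g *m origin _ _)| =
     `|ip v (origin _ _)| * `|ip u (origin _ _)|) ->
  limit_set Gam xi -> ip v (boundary_pt xi) = 0 \/ ip u (boundary_pt xi) = 0.
Proof.
move=> inv xl; set z := boundary_pt xi; set K := `|_| * `|_| in inv.
have K0 : 0 <= K by rewrite mulr_ge0.
pose s (w : V) : C := \sum_i `|w i 0|.
have s0 (w : V) : 0 <= s w by rewrite sumr_ge0.
have lip (w x : V) : (forall i, `|x i 0| <= 1) -> `|ip w x| <= s w.
  move=> x1; apply: le_trans (ip_norm_le _ _) _; apply: ler_sum => i _.
  by rewrite ler_piMr.
have z1 i : `|z i 0| <= 1.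
  by case: xl => xs _; apply: ball_coord; rewrite ?boundary_pt_last ?boundary_pt_null.
suff: `|ip v z| * `|ip u z| = 0.
  by move/eqP; rewrite mulf_eq0 !normr_eq0 => /orP[] /eqP; [left|right].
(* The constant collects the bound on the product at [dir g] and the two errors made in replacing
   [z] by [dir g]. *)
apply: (@small_le0 _ _ (K + s v * s u + s v * s u)); rewrite ?addr_ge0 ?mulr_ge0 // => eps e0 e1.
have [g [Gg gl gd]] := limit_set_approx xl e0 e1.
have gp := Gp Gg.
have g1 i : `|dir g i 0| <= 1 by exact: dir_le1.
have zg (w : V) : `|ip w z| <= `|ip w (dir g)| + s w * eps.
  rewrite -[ip w z](subrK (ip w (dir g))) (le_trans (ler_normD _ _)) // addrC lerD2l.
  by apply: ip_lipschitz => i; rewrite distrC.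
have prod : `|ip v (dir g)| * `|ip u (dir g)| <= K * eps.
  rewrite !ipZr !normrM mulrACA (inv _ Gg) normfV mulrC ler_wpM2l //.
  apply: le_trans (_ : eps * eps <= _); last by rewrite ler_piMr // ltW.
  by rewrite ler_pM // invr_ge0.
have step : `|ip v z| * `|ip u z| <= (`|ip v (dir g)| + s v * eps) * `|ip u z|.
  by rewrite ler_wpM2r.
apply: le_trans step _; rewrite mulrDl.
have step2 : `|ip v (dir g)| * `|ip u z| <= K * eps + s v * (s u * eps).
  apply: le_trans (_ : `|ip v (dir g)| * (`|ip u (dir g)| + s u * eps) <= _).
    by rewrite ler_wpM2l.
  by rewrite mulrDr lerD // ler_wpM2r ?mulr_ge0 ?(ltW e0) // lip.
have step3 : s v * eps * `|ip u z| <= s v * eps * s u.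
  by rewrite ler_wpM2l ?mulr_ge0 ?(ltW e0) ?lip.
apply: le_trans (lerD step2 step3) _.
by rewrite -subr_ge0 [X in 0 <= X](_ : _ = 0) //; ring.
Qed.

(** All limit points orthogonal to [v] coincide, since orthogonal null vectors are proportional, and
    likewise for [u]; three distinct limit points do not fit. *)
Lemma invariant_pair_elementary (v u : V) : hyperbolic_pair v u ->
  (forall g, Gam g -> `|ip v (g *m origin _ _)| * `|ip u (g *m origin _ _)| =
     `|ip v (origin _ _)| * `|ip u (origin _ _)|) ->
  nonelementary Gam -> False.
Proof.
move=> hyp inv [x1 [x2 [x3 [l1 [l2 [l3 [n12 [n13 n23]]]]]]]].
have [vv uu uv] := hyp.
have v0 := hyperbolic_pair_neq0 hyp; have u0 := hyperbolic_pair_neq0 (hyperbolic_pairC hyp).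
have uniq_orth (w : V) x y : ip w w = 0 -> w != 0 -> limit_set Gam x -> limit_set Gam y ->
    ip w (boundary_pt x) = 0 -> ip w (boundary_pt y) = 0 -> x = y.
  move=> ww w0 [xs _] [ys _] wx wy; apply: boundary_pt_orth => //.
  have [t ->] := null_orth_prop ww w0 wx (boundary_pt_null xs).
  by rewrite ipZl wy mulr0.
have ov x y := uniq_orth v x y vv v0; have ou x y := uniq_orth u x y uu u0.
case: (invariant_pair_limit inv l1) => o1; case: (invariant_pair_limit inv l2) => o2;
case: (invariant_pair_limit inv l3) => o3.
- by apply: n12; apply: ov.
- by apply: n12; apply: ov.
- by apply: n13; apply: ov.
- by apply: n23; apply: ou.
- by apply: n23; apply: ov.
- by apply: n13; apply: ou.
- by apply: n12; apply: ou.
- by apply: n12; apply: ou.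
Qed.
End Accumulation.

(** * Existence of loxodromic elements *)
Section LoxodromicExistence.
Variables (R : realType) (n : nat).
Local Notation C := R[i].
Local Notation J := (Jform R n).
Local Notation V := 'cV[C]_n.+1.
Local Notation M := 'M[C]_n.+1.

Lemma char_poly_tr (A : M) : char_poly A^T = char_poly A.
Proof. by rewrite /char_poly -det_tr /char_poly_mx linearB /= tr_scalar_mx map_trmx trmxK. Qed.

Lemma large_trace_eigenvalue (g : M) : n.+1%:R < `|\tr g| ->
  exists2 lam, 1 < `|lam| & root (char_poly g) lam.
Proof.
move=> tg; have [r pE] := closed_field_poly_normal (char_poly g).
move: pE; rewrite (monicP (char_poly_monic g)) scale1r => pE.
have sr : size r = n.+1.
  by have := size_char_poly g; rewrite pE size_prod_XsubC => -[].
have trE : \tr g = \sum_(z <- r) z.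
  by apply: oppr_inj; rewrite -char_poly_trace // pE -coefPn_prod_XsubC sr.
have [/hasP[lam lr l1]|/hasPn small] := boolP (has (fun z : C => 1 < `|z|) r).
  by exists lam; rewrite // pE root_prod_XsubC.
have : `|\tr g| <= n.+1%:R.
  rewrite trE; apply: le_trans (ler_norm_sum _ _ _) _.
  apply: le_trans (_ : \sum_(z <- r) 1 <= _); last first.
    by rewrite big_const_seq count_predT sr iter_addr_0.
  rewrite big_seq [leRHS]big_seq; apply: ler_sum => z zr.
  by have := small z zr; rewrite -real_leNgt.
by move=> /(lt_le_trans tg); rewrite ltxx.
Qed.

(** Eigenvectors whose multiplier has modulus different from 1 are null. They cannot be orthogonal:
    they would be proportional, giving [lam = lam^*^-1] and [|lam| = 1]. *)
Lemma large_trace_loxodromic (g : M) : preserves g -> n.+1%:R < `|\tr g| ->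
  exists v u lam, loxodromic g v u lam.
Proof.
move=> gp tg; have [lam l1 lr] := large_trace_eigenvalue tg.
have l0 := gt1_neq0 l1.
have : eigenvalue g lam by rewrite eigenvalue_root_char.
move=> /eigenvalueP[w wg w0].
have : eigenvalue g^T lam by rewrite eigenvalue_root_char char_poly_tr.
move=> /eigenvalueP[v' v'g v'0].
(* [eigenvalueP] yields row vectors: the one for [g^T] transposes to an eigenvector of [g], and the
   one for [g] becomes, through the form, an eigenvector [x] of the inverse. *)
pose v : V := v'^T; pose x : V := J *m hadj w.
have gv : g *m v = lam *: v by rewrite /v -[g]trmxK -trmx_mul v'g linearZ.
have v0 : v != 0 by rewrite trmx_eq0.
have x0 : x != 0.
  apply: contraNneq w0 => x0; rewrite -[w]hadjK.
  by rewrite -[hadj w]mul1mx -(Jform_involutive R n) -mulmxA -/x x0 mulmx0 hadj0.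
have gx : g *m x = lam^*^-1 *: x.
  have gU := preserves_unit gp.
  have : invmx g *m x = lam^* *: x.
    by rewrite preserves_inv // /x -!mulmxA (mulmxA J J) Jform_involutive mul1mx -hadjM wg hadjZ -scalemxAr.
  move=> e; rewrite -[x in LHS]scale1r -(@mulVf _ lam^*) ?conjC_eq0 // -scalerA -e -scalemxAr mulKVmx //.
have ln1 : `|lam| ^+ 2 != 1 by rewrite gt_eqF // exprn_egt1.
have vv : ip v v = 0.
  have := preserves_ip v v gp; rewrite gv !ip_lin mulrA mulrC -normCK => /eqP.
  by rewrite -subr_eq0 -[X in _ - X]mulr1 -mulrBr mulf_eq0 subr_eq0 (negPf ln1) orbF => /eqP.
have xx : ip x x = 0.
  have := preserves_ip x x gp; rewrite gx !ip_lin fmorphV /= conjCK mulrA -invfM [lam^* * _]mulrC -normCK => /eqP.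
  rewrite -subr_eq0 -[X in _ - X]mul1r -mulrBl mulf_eq0 subr_eq0 invr_eq1 (negPf ln1) => /eqP //.
have xv : ip x v != 0.
  apply/eqP => xv; have [t vt] := null_orth_prop xx x0 xv vv.
  have t0 : t != 0 by apply: contraNneq v0 => t0; rewrite vt t0 scale0r.
  have : (lam - lam^*^-1) *: v == 0.
    by rewrite scalerBl -gv [in g *m v]vt -scalemxAr gx scalerA mulrC -scalerA -vt subrr.
  rewrite scaler_eq0 (negPf v0) orbF subr_eq0 => /eqP e.
  by move: ln1; rewrite normCK {1}e mulVf ?conjC_eq0 // eqxx.
exists v, ((ip x v)^*^-1 *: x), lam; split=> //.
  by rewrite -scalemxAr gx scalerA mulrC -scalerA.
by split; rewrite // !ip_lin ?xx ?mulr0 // fmorphV /= conjCK mulVf.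
Qed.

Lemma mxtrace_norm_le (A : M) b : (forall i j, `|A i j| <= b) -> `|\tr A| <= n.+1%:R * b.
Proof.
move=> Ab; apply: le_trans (ler_norm_sum _ _ _) _.
apply: le_trans (_ : \sum_(i < n.+1) b <= _); first exact: ler_sum.
by rewrite sumr_const card_ord mulr_natl.
Qed.

Lemma mulmx_norm_le1 p q r (A : 'M[C]_(p, q.+1)) (B : 'M[C]_(q.+1, r)) :
  (forall i j, `|A i j| <= 1) -> (forall i j, `|B i j| <= 1) ->
  forall i j, `|(A *m B) i j| <= q.+1%:R.
Proof.
move=> A1 B1 i j; rewrite mxE; apply: le_trans (ler_norm_sum _ _ _) _.
apply: le_trans (_ : \sum_(i < q.+1) 1 <= _); last by rewrite sumr_const card_ord.
by apply: ler_sum => k _; rewrite normrM mulr_ile1.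
Qed.

Lemma ip_bound1 (x y : V) b : (forall i, `|x i 0| <= 1) -> (forall i, `|y i 0| <= b) ->
  `|ip x y| <= n.+1%:R * b.
Proof. by move=> x1 yb; have := ip_bound x1 yb; rewrite mul1r. Qed.

Lemma preserves_mxE (g : M) :
  g = residue g - g ord_max ord_max *: rank1 (dir g) (dir (invmx g)).
Proof. by rewrite addrK. Qed.

Lemma trace_dir (g : M) : \tr g =
  \tr (residue g) - g ord_max ord_max * ip (dir (invmx g)) (dir g).
Proof.
rewrite {1}[g]preserves_mxE linearB /= linearZ /= -[rank1 _ _]mulmx1 mxtrace_rank1.
by rewrite mul1mx.
Qed.

Lemma mxtrace_mul_rank1 (F G : M) (d c : C) (a a' b b' : V) :
  \tr ((F - d *: rank1 a a') *m (G - c *: rank1 b b')) =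
  \tr (F *m G) - c * ip b' (F *m b) - d * ip a' (G *m a) + d * c * (ip a' b * ip b' a).
Proof.
have tr1 x y : \tr (rank1 x y : M) = ip y x.
  by rewrite -[rank1 x y]mulmx1 mxtrace_rank1 mul1mx.
rewrite mulmxBl 2!mulmxBr -!scalemxAl -!scalemxAr.
rewrite [rank1 a a' *m rank1 b b']mul_rank1 rank1E rank1Zl mul_rank1.
rewrite !raddfB /= !mxtraceZ mxtrace_rank1 !tr1; ring.
Qed.

Lemma trace_mul_dir (g h : M) : \tr (g *m h) =
  \tr (residue g *m residue h)
  - h ord_max ord_max * ip (dir (invmx h)) (residue g *m dir h)
  - g ord_max ord_max * ip (dir (invmx g)) (residue h *m dir g)
  + g ord_max ord_max * h ord_max ord_max *
    (ip (dir (invmx g)) (dir h) * ip (dir (invmx h)) (dir g)).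
Proof. by rewrite {1}[g]preserves_mxE {1}[h]preserves_mxE; exact: mxtrace_mul_rank1. Qed.

(** Abstracts [trace_mul_dir]: dividing the trace identity by both corner entries [d] and [c]
    isolates [s], and every other term carries a small factor. *)
Lemma product_estimate (t f w1 w2 d c s N eps : C) :
  t = f - c * w1 - d * w2 + d * c * s -> `|t| <= N -> `|f| <= N * N ->
  `|w1| <= N * N -> `|w2| <= N * N -> d != 0 -> c != 0 ->
  `|d|^-1 <= eps -> `|c|^-1 <= eps -> eps <= 1 ->
  `|s| <= (N + N * N + N * N + N * N) * eps.
Proof.
move=> tE tN fN w1N w2N d0 c0 de ce e1.
have N0 : 0 <= N by apply: le_trans tN.
have e0 : 0 <= eps by apply: le_trans de; rewrite invr_ge0.
have -> : s = (t - f) * (d^-1 * c^-1) + w1 * d^-1 + w2 * c^-1 by rewrite tE; field; rewrite d0 c0.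
have dc : `|d|^-1 * `|c|^-1 <= eps.
  by rewrite -[eps]mulr1 ler_pM ?invr_ge0 // (le_trans ce).
rewrite [leRHS]mulrDl [in leRHS]mulrDl.
apply: le_trans (ler_normD _ _) _; apply: lerD; last by rewrite normrM normfV ler_pM ?invr_ge0.
apply: le_trans (ler_normD _ _) _; apply: lerD; last by rewrite normrM normfV ler_pM ?invr_ge0.
rewrite !normrM !normfV ler_pM ?mulr_ge0 ?invr_ge0 //.
by apply: le_trans (ler_normB _ _) _; apply: lerD.
Qed.

(** The cross terms contribute [4 * N^2 * eps] and the squared error at most as much again, whence
    the 8. *)
Lemma square_estimate (k p q N K eps : C) : 0 <= N -> 0 <= eps -> eps <= 1 ->
  `|k| <= `|p| + 2%:R * N * eps -> `|k| <= `|q| + 2%:R * N * eps ->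
  `|p| <= N -> `|q| <= N -> `|p| * `|q| <= K * eps ->
  `|k| ^+ 2 <= (K + 8%:R * (N * N)) * eps.
Proof.
move=> N0 e0 e1 kp kq pN qN pq; have t0 : 0 <= 2%:R * N * eps by rewrite !mulr_ge0.
apply: le_trans (_ : (`|p| + 2%:R * N * eps) * (`|q| + 2%:R * N * eps) <= _).
  by rewrite expr2 ler_pM.
have -> : (`|p| + 2%:R * N * eps) * (`|q| + 2%:R * N * eps) =
  `|p| * `|q| + (2%:R * N * eps * `|p| + 2%:R * N * eps * `|q| + (2%:R * N * eps) * (2%:R * N * eps)) by ring.
rewrite [leRHS]mulrDl; apply: lerD => //.
have s0 : 2%:R * N * eps * (2%:R * N * eps) <= 2%:R * N * eps * (2%:R * N).
  by rewrite ler_wpM2l // ler_piMr // mulr_ge0.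
apply: le_trans (lerD (lerD (ler_wpM2l t0 pN) (ler_wpM2l t0 qN)) s0) _.
by rewrite -subr_ge0 [X in 0 <= X](_ : _ = 0) //; ring.
Qed.

Variable Gam : M -> Prop.
Hypothesis sub : is_subgroup_SU_n1 Gam.
Let Gp g : Gam g -> preserves g.
Proof. exact: (Gam_preserves sub). Qed.
Let Gam_inv g : Gam g -> Gam (invmx g).
Proof. by case: sub => _ [_ [H _]]; exact: H. Qed.

(** Both directions have last coordinate 1, so their squared distance is the form of their
    difference, at most [-2 Re X] with [X = ip (dir (invmx g)) (dir g)]. By [trace_dir] a bounded
    trace makes [X] as small as the inverse of the corner entry. *)
Lemma limit_set_approx2 (T : C) xi eps : 0 <= T -> (forall g, Gam g -> `|\tr g| <= T) ->
  limit_set Gam xi -> 0 < eps -> eps <= 1 ->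
  exists g, [/\ Gam g, forall i, `|dir g i 0 - boundary_pt xi i 0| <= eps,
    forall i, `|dir (invmx g) i 0 - boundary_pt xi i 0| <= eps &
                `|g ord_max ord_max|^-1 <= eps].
Proof.
move=> T0 trT xl e0 e1; have h0 : 0 < eps / 2%:R by rewrite divr_gt0.
pose S : C := T + n.+1%:R; have S0 : 0 <= S by rewrite addr_ge0.
have S1 : 1 <= 2%:R * S + 1 by rewrite lerDr mulr_ge0.
have S2 : 0 < 2%:R * S + 1 by apply: lt_le_trans S1.
have h1 : eps / 2%:R <= 1 by rewrite ler_pdivrMr // mul1r (le_trans e1) // ler1n.
(* Makes [2 * S * del], which bounds the squared distance between the two directions, at most
   [(eps / 2)^2]; the other half of [eps] covers the distance from [dir g] to the limit point. *)
pose del := (eps / 2%:R) ^+ 2 / (2%:R * S + 1).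
have d0 : 0 < del by rewrite divr_gt0 // exprn_gt0.
have dh : del <= eps / 2%:R.
  rewrite ler_pdivrMr // expr2 ler_wpM2l // ?(ltW h0) // (le_trans h1) //.
have he : eps / 2%:R <= eps by rewrite ler_pdivrMr // ler_peMr ?ler1n // ltW.
have [g [Gg gl gd]] := limit_set_approx Gp xl d0 (le_trans dh h1).
have gp := Gp Gg; have gip := preservesV gp; have c0 := corner_neq0 gp.
have close i : `|dir (invmx g) i 0 - dir g i 0| <= eps / 2%:R.
  set y := dir (invmx g) - dir g.
  have -> : dir (invmx g) i 0 - dir g i 0 = y i 0 by rewrite /y col_sub.
  have yl : y ord_max 0 = 0 by rewrite /y col_sub !dir_last // subrr.
  rewrite -(@ler_pXn2r _ 2) ?nnegrE ?(ltW h0) //; apply: le_trans (spatial_le i yl) _.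
  have -> : spatial y = ip y y by rewrite ipxx yl normr0 expr0n subr0.
  set X := ip (dir (invmx g)) (dir g).
  have Xb : `|X| <= S * del.
    have := trace_dir g; rewrite -/X => tE.
    have dX : g ord_max ord_max * X = \tr (residue g) - \tr g by rewrite tE; ring.
    have : `|g ord_max ord_max * X| <= S.
      rewrite dX (le_trans (ler_normB _ _)) // addrC lerD ?trT //.
      by rewrite -[leRHS]mulr1 mxtrace_norm_le // => a b; apply: residue_bound.
    rewrite normrM mulrC -ler_pdivlMr ?normr_gt0 // => /le_trans; apply.
    by rewrite ler_wpM2l.
  have -> : ip y y = ip (dir (invmx g)) (dir (invmx g)) + ip (dir g) (dir g) - (X + X^*).
    by rewrite /y !(ipDl, ipDr, ipNl, ipNr) -/X (ipC (dir (invmx g)) (dir g)) -/X; ring.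
  have neg1 : ip (dir (invmx g)) (dir (invmx g)) + ip (dir g) (dir g) <= 0.
    by rewrite !ip_dir // -opprD oppr_le0 addr_ge0 ?exprn_ge0 ?invr_ge0.
  have rX : - (X + X^*) \is Num.real by apply/CrealP; rewrite rmorphN rmorphD /= conjCK addrC.
  apply: le_trans (_ : - (X + X^*) <= _); first by rewrite gerDr.
  apply: le_trans (real_ler_norm rX) _; rewrite normrN.
  apply: le_trans (ler_normD _ _) _; rewrite norm_conjC.
  apply: le_trans (lerD Xb Xb) _; rewrite /del mulrA -mulrDl ler_pdivrMr // -mulrDl mulrC.
  by rewrite ler_wpM2l ?exprn_ge0 ?(ltW h0) // mulr_natl mulr2n lerDl.
exists g; split=> // [i|i|].
- exact: le_trans (gl i) (le_trans dh he).
- rewrite [leRHS](splitr eps); apply: le_trans (ler_distD (dir g i 0) _ _) _.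
  by rewrite lerD // (le_trans (gl i)).
- exact: le_trans gd (le_trans dh he).
Qed.

(** The pairing [k] of the two limit points is approximated by both factors [p] and [q] of the
    leading term of the trace of [g *m h]; bounded traces make [p * q] small, hence [k = 0]. *)
Lemma nonelementary_loxodromic : nonelementary Gam ->
  exists h v u lam, Gam h /\ loxodromic h v u lam.
Proof.
move=> [x1 [x2 [_ [l1 [l2 [_ [n12 _]]]]]]].
have [[h [Gh th]]|none] := pselect (exists h, Gam h /\ n.+1%:R < `|\tr h|).
  have [v [u [lam lox]]] := large_trace_loxodromic (Gp Gh) th.
  by exists h, v, u, lam.
exfalso; pose N : C := n.+1%:R; have N0 : 0 <= N by [].
have trN g : Gam g -> `|\tr g| <= N.
  move=> Gg; rewrite real_leNgt ?realn ?normr_real //; apply/negP => tg.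
  by apply: none; exists g.
have [xs1 _] := l1; have [xs2 _] := l2.
pose k := ip (boundary_pt x1) (boundary_pt x2).
suff: `|k| ^+ 2 = 0.
  by move/eqP; rewrite sqrf_eq0 normr_eq0 => /eqP /(boundary_pt_orth xs1 xs2).
pose K := N + N * N + N * N + N * N + 8%:R * (N * N).
have K0 : 0 <= K by rewrite /K !(addr_ge0, mulr_ge0).
apply: (small_le0 (exprn_ge0 2 (normr_ge0 k)) K0) => eps e0 e1.
have [g [Gg ga ga' gd]] := limit_set_approx2 N0 trN l1 e0 e1.
have [h [Gh hb hb' hc]] := limit_set_approx2 N0 trN l2 e0 e1.
have gp := Gp Gg; have hp := Gp Gh.
set a := dir g in ga; set a' := dir (invmx g) in ga'.
set b := dir h in hb; set b' := dir (invmx h) in hb'.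
set d := g ord_max ord_max in gd; set c := h ord_max ord_max in hc.
have d0 : 0 < `|d| by rewrite normr_gt0 corner_neq0.
have c0 : 0 < `|c| by rewrite normr_gt0 corner_neq0.
have a1 i : `|a i 0| <= 1 by apply: dir_le1.
have a'1 i : `|a' i 0| <= 1 by apply/dir_le1/preservesV.
have b1 i : `|b i 0| <= 1 by apply: dir_le1.
have b'1 i : `|b' i 0| <= 1 by apply/dir_le1/preservesV.
have F1 i j : `|residue g i j| <= 1 by apply: residue_bound.
have G1 i j : `|residue h i j| <= 1 by apply: residue_bound.
have z1 x i : in_sphere x -> `|boundary_pt x i 0| <= 1.
  by move=> xs; apply: ball_coord; rewrite ?boundary_pt_last ?boundary_pt_null.
set p := ip a' b; set q := ip b' a.
have pq : `|p| * `|q| <= (N + N * N + N * N + N * N) * eps.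
  have Gb : `|ip b' (residue g *m b)| <= N * N.
    by apply: ip_bound1 => // i; apply: mulmx_norm_le1 => // l j; rewrite ord1.
  have Ga : `|ip a' (residue h *m a)| <= N * N.
    by apply: ip_bound1 => // i; apply: mulmx_norm_le1 => // l j; rewrite ord1.
  have GF : `|\tr (residue g *m residue h)| <= N * N.
    by apply: mxtrace_norm_le => i j; apply: mulmx_norm_le1.
  have ghN : `|\tr (g *m h)| <= N by apply: trN; case: sub => _ [H _]; apply: H.
  have := product_estimate (trace_mul_dir g h) ghN GF Gb Ga (corner_neq0 gp) (corner_neq0 hp) gd hc e1.
  by rewrite [X in X <= _]normrM.
have near (x y : V) s t : (forall i, `|x i 0 - boundary_pt s i 0| <= eps) ->
    (forall i, `|y i 0 - boundary_pt t i 0| <= eps) -> (forall i, `|y i 0| <= 1) ->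
    in_sphere s -> `|ip (boundary_pt s) (boundary_pt t)| <= `|ip x y| + 2%:R * N * eps.
  move=> xs yt y1 ss.
  have -> : ip (boundary_pt s) (boundary_pt t) =
      ip x y - (ip (x - boundary_pt s) y + ip (boundary_pt s) (y - boundary_pt t)).
    by rewrite !ip_lin; ring.
  apply: le_trans (ler_normB _ _) _; rewrite lerD2l.
  apply: le_trans (ler_normD _ _) _.
  rewrite -mulrA mulrDl mul1r; apply: lerD.
    by rewrite -[eps in leRHS]mulr1; apply: ip_bound => // i; rewrite col_sub.
  rewrite -[eps in leRHS]mul1r; apply: ip_bound => i; rewrite ?col_sub //.
  by apply: z1.
have kp : `|k| <= `|p| + 2%:R * N * eps by apply: near.
have kq : `|k| <= `|q| + 2%:R * N * eps by rewrite /k ipC norm_conjC; apply: near.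
have pN : `|p| <= N by have := ip_bound1 a'1 b1; rewrite mulr1.
have qN : `|q| <= N by have := ip_bound1 b'1 a1; rewrite mulr1.
by apply: square_estimate pq; rewrite // ltW.
Qed.
End LoxodromicExistence.

(** * Consequences of real traces *)
Section RealTraces.
Variables (R : realType) (n : nat).
Local Notation C := R[i].
Local Notation J := (Jform R n).
Local Notation V := 'cV[C]_n.+1.
Local Notation M := 'M[C]_n.+1.

(** The two multipliers have a product of modulus 1, because [ip u v = 1] is preserved. *)
Lemma permuted_pair_norm (g : M) (v u x : V) : hyperbolic_pair v u -> preserves g ->
  (exists a b, g *m v = a *: v /\ g *m u = b *: u) \/
  (exists a b, g *m v = a *: u /\ g *m u = b *: v) ->
  `|ip (g *m v) x| * `|ip (g *m u) x| = `|ip v x| * `|ip u x|.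
Proof.
move=> [vv uu uv] gp; have vu : ip v u = 1 by rewrite ipC uv conjC1.
have normZ c y : `|ip (c *: y) x| = `|c| * `|ip y x| by rewrite ipZl normrM norm_conjC.
have := congr1 Num.norm (preserves_ip u v gp); rewrite uv normr1.
move=> e [] [a [b [gv gu]]]; move: e; rewrite gv gu ipZr ipZl ?uv ?vu mulr1 normrM norm_conjC !normZ;
  move: `|a| `|b| `|ip v x| `|ip u x| => a' b' v' u' ab.
  by rewrite mulrACA ab mul1r.
by rewrite mulrACA ab mul1r mulrC.
Qed.

Lemma pair_decomposition (v u s : V) : hyperbolic_pair v u ->
  ip v (s - ip u s *: v - ip v s *: u) = 0 /\ ip u (s - ip u s *: v - ip v s *: u) = 0.
Proof.
move=> [vv uu uv]; have vu : ip v u = 1 by rewrite ipC uv conjC1.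
by rewrite !ip_lin vv uu uv vu; split; ring.
Qed.

Variable Gam : M -> Prop.
Hypothesis sub : is_subgroup_SU_n1 Gam.
Hypothesis disc : discrete_set Gam.
Hypothesis nonelem : nonelementary Gam.
Hypothesis trace_real : forall g, Gam g -> \tr g \is Num.real.

Let Gp g : Gam g -> preserves g.
Proof. exact: (Gam_preserves sub). Qed.
Let Gam_inv g : Gam g -> Gam (invmx g).
Proof. by case: sub => _ [_ [H _]]; exact: H. Qed.
Let Gam_mul g h : Gam g -> Gam h -> Gam (g *m h).
Proof. by case: sub => _ [H _]; exact: H. Qed.

Lemma not_permuting_pair (v u : V) : hyperbolic_pair v u ->
  ~ (forall g, Gam g ->
       (exists a b, g *m v = a *: v /\ g *m u = b *: u) \/
       (exists a b, g *m v = a *: u /\ g *m u = b *: v)).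
Proof.
move=> hyp perm; apply: (invariant_pair_elementary Gp hyp _ nonelem) => g Gg.
have gi := Gam_inv Gg.
have := permuted_pair_norm (origin R n) hyp (Gp gi) (perm _ gi).
by rewrite !(preserves_ipl _ _ (Gp gi)) invmxK.
Qed.

(** Otherwise every [g *m v] is a null vector orthogonal to [v], so the whole group keeps the line
    of [v], hence by discreteness that of [u]. *)
Lemma not_fixing_attracting h v u lam : Gam h -> loxodromic h v u lam ->
  exists2 g, Gam g & ip v (g *m v) != 0.
Proof.
move=> Gh lox; have [_ _ _ _ hyp] := lox; have [vv uu uv] := hyp.
have v0 := hyperbolic_pair_neq0 hyp.
apply: contrapT => none; apply: (not_permuting_pair hyp) => g Gg; left.
have vgv : ip v (g *m v) = 0.
  by apply/eqP/negPn/negP => ne; apply: none; exists g.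
have [|a ga] := null_orth_prop vv v0 vgv; first by rewrite (preserves_ip _ _ (Gp Gg)).
have [b gb] := discrete_fix_repelling sub disc Gh lox Gg ga.
by exists a, b.
Qed.

(** * Reality of matrix coefficients along a loxodromic axis *)

Section Axis.
Variables (h : M) (v u : V) (lam : C).
Hypotheses (Gh : Gam h) (lox : loxodromic h v u lam).

Let lam_real : lam \is Num.real.
Proof. by apply: loxodromic_real lox _ => k; apply: trace_real; exact: Gam_exp. Qed.

Lemma cross_real g : Gam g -> ip u (g *m v) \is Num.real.
Proof.
move=> Gg; apply: loxodromic_coef_real lox lam_real _ => k.
by apply: trace_real; apply: Gam_mul => //; exact: Gam_exp.
Qed.

Lemma cross_real' g : Gam g -> ip v (g *m u) \is Num.real.
Proof.
move=> Gg; rewrite ipC; have gi := Gam_inv Gg.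
rewrite (preserves_ipl _ _ (Gp Gg)).
by have /CrealP -> := cross_real gi; exact: cross_real.
Qed.

(** The inverse of [h] attracts towards [u], so the product is the leading coefficient of
    [ip u (g *m h^-k *m g' *m v)], real by [cross_real]. *)
Lemma self_product_real g g' : Gam g -> Gam g' ->
  ip u (g *m u) * ip v (g' *m v) \is Num.real.
Proof.
move=> Gg Gg'; apply: loxodromic_coef2_real (loxodromicV lox) _ _.
  by have /CrealP -> := lam_real.
move=> k; apply: cross_real; apply: Gam_mul => //; apply: Gam_mul => //.
by apply: Gam_exp => //; apply: Gam_inv.
Qed.

(** Passing from [g0] to its inverse conjugates [c], so [d * c] and [d * c^*] are both real and
    [c^2] is real. The sign of [c] then spreads to all pairings of [u] through products with [c],
    and back to those of [v] through [d]. *)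
Lemma self_pairing_sign : exists e : C, (e = 1 \/ e = -1) /\ forall g, Gam g ->
  (ip v (g *m v))^* = e * ip v (g *m v) /\ (ip u (g *m u))^* = e * ip u (g *m u).
Proof.
have [g0 Gg0 c0] := not_fixing_attracting Gh lox.
have [g1 Gg1 d0] := not_fixing_attracting (Gam_inv Gh) (loxodromicV lox).
set c := ip v _ in c0; set d := ip u _ in d0.
have dc := self_product_real Gg1 Gg0; rewrite -/c -/d in dc.
have dc' : d * c^* \is Num.real.
  have := self_product_real Gg1 (Gam_inv Gg0); rewrite -/d.
  by rewrite -(preserves_ipl _ _ (Gp Gg0)) -ipC.
have cs : exists e : C, (e = 1 \/ e = -1) /\ c^* = e * c.
  move/CrealP: dc; move/CrealP: dc'; rewrite !rmorphM /= conjCK => e1 e2.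
  have : (c^* - c) * (c^* + c) == 0.
    have : d * ((c^* - c) * (c^* + c)) = 0.
      transitivity (d * c^* * c^* - d * c * c); first by ring.
      by rewrite -e1 -e2; ring.
    by move/eqP; rewrite mulf_eq0 (negPf d0).
  rewrite mulf_eq0 => /orP[]; rewrite ?subr_eq0 ?addr_eq0 => /eqP cE.
    by exists 1; rewrite mul1r; split; [left|].
  by exists (-1); rewrite mulN1r; split; [right|].
have [e [e1 ce]] := cs; exists e; split=> // g Gg.
have ee : e * e = 1 by case: e1 => ->; rewrite ?mulr1 // mulrNN mulr1.
have e0 : e != 0 by apply: contraTneq isT => e0; move: ee => /eqP; rewrite e0 mul0r eq_sym oner_eq0.
have ue y : y * c \is Num.real -> y^* = e * y.
  move/CrealP; rewrite rmorphM /= ce => /eqP.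
  rewrite mulrA -subr_eq0 -mulrBl mulf_eq0 (negPf c0) orbF subr_eq0 => /eqP ye.
  by rewrite -[in RHS]ye mulrCA ee mulr1.
have de : d^* = e * d by apply: ue.
split; last by apply/ue/self_product_real.
have := self_product_real Gg1 Gg; rewrite -/d => /CrealP; rewrite rmorphM /= de => /eqP.
rewrite -mulrA mulrCA -subr_eq0 -mulrBr mulf_eq0 (negPf d0) subr_eq0 => /eqP ye.
by rewrite -[in RHS]ye mulrA ee mul1r.
Qed.

(* With these pairings imaginary, the components of [g v] and [g u] orthogonal
   to [v] and [u] are null, hence zero. *)
Lemma antireal_orbit_decomposition g : Gam g ->
  (ip v (g *m v))^* = - ip v (g *m v) -> (ip u (g *m u))^* = - ip u (g *m u) ->
  g *m v = ip u (g *m v) *: v + ip v (g *m v) *: u /\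
  g *m u = ip u (g *m u) *: v + ip v (g *m u) *: u.
Proof.
move=> Gg iv iu; have [_ _ _ _ hyp] := lox; have [vv uu uv] := hyp.
have vu : ip v u = 1 by rewrite ipC uv conjC1.
have key s : ip s s = 0 -> (ip u s)^* * ip v s + (ip v s)^* * ip u s = 0 ->
    s = ip u s *: v + ip v s *: u.
  move=> ss o; have [rv ru] := pair_decomposition s hyp.
  suff : s - ip u s *: v - ip v s *: u = 0.
    by move=> /eqP; rewrite -addrA -opprD subr_eq0 => /eqP.
  apply: (orth_pair_eq0 hyp rv ru).
  rewrite !(ipDl, ipNl, ipZl) rv ru !ip_lin (ipC u s) (ipC v s) ss.
  move: o; move: (ip u s) (ip v s) (ip u s)^* (ip v s)^* => a b a' b' o.
  transitivity (- (a' * b + b' * a)); first by ring.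
  by rewrite o oppr0.
have gp := Gp Gg.
have /CrealP r1 := cross_real Gg; have /CrealP r2 := cross_real' Gg.
split; apply: key; rewrite ?preserves_ip //.
  by rewrite r1 iv mulNr [X in X - _]mulrC subrr.
by rewrite iu r2 mulNr [X in _ + X]mulrC addNr.
Qed.
End Axis.
End RealTraces.

(** * Orthonormal frames *)
Section Frames.
Variables (R : realType) (n : nat).
Local Notation C := R[i].
Local Notation J := (Jform R n).
Local Notation V := 'cV[C]_n.+1.
Local Notation M := 'M[C]_n.+1.

Lemma gramE p q (A : 'M[C]_(n.+1, p)) (B : 'M[C]_(n.+1, q)) i j :
  (hadj A *m J *m B) i j = ip (col i A) (col j B).
Proof.
have E : hadj (col i A) = row i (hadj A) by apply/matrixP=> a b; rewrite hadjE !mxE.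
rewrite /ip E -(row_mul i (hadj A) J) [LHS]mxE [RHS]mxE.
by apply: eq_bigr => k _; rewrite [row _ _ _ _]mxE [col _ _ _ _]mxE.
Qed.

Lemma real_mulmx p q r (A : 'M[C]_(p, q)) (B : 'M[C]_(q, r)) :
  (forall i j, A i j \is Num.real) -> (forall i j, B i j \is Num.real) ->
  forall i j, (A *m B) i j \is Num.real.
Proof.
by move=> Ar Br i j; rewrite mxE; apply: rpred_sum => k _; rewrite rpredM.
Qed.

Lemma Jform_real m i j : Jform R m i j \is Num.real.
Proof.
by rewrite !mxE rpredMn //; case: ifP; rewrite ?rpredN rpred1.
Qed.

(** Zero is not a constructor but comes from a generator, hence the witness [S s] in the closure
    lemmas. *)
Inductive real_span (S : V -> Prop) : V -> Prop :=
| real_span_gen s : S s -> real_span S s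
| real_span_comb a x y : a \is Num.real -> real_span S x -> real_span S y ->
    real_span S (a *: x + y).

Lemma real_span0 S s : S s -> real_span S 0.
Proof.
move=> Ss; have -> : 0 = -1 *: s + s by rewrite scaleN1r addNr.
by apply: real_span_comb; rewrite ?rpredN ?rpred1 //; apply: real_span_gen.
Qed.

Lemma real_spanZ S s a x : S s -> a \is Num.real -> real_span S x -> real_span S (a *: x).
Proof.
move=> Ss ar rx; rewrite -[_ *: _]addr0; apply: real_span_comb => //; exact: real_span0 Ss.
Qed.

Lemma real_spanD S x y : real_span S x -> real_span S y -> real_span S (x + y).
Proof. by move=> rx ry; rewrite -[x]scale1r; apply: real_span_comb; rewrite ?rpred1. Qed.

Lemma real_spanB S s x y : S s -> real_span S x -> real_span S y -> real_span S (x - y).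
Proof.
move=> Ss rx ry; apply: real_spanD => //; rewrite -scaleN1r.
by apply: real_spanZ Ss _ ry; rewrite rpredN rpred1.
Qed.

Lemma real_span_mulmx S s p (X : 'M[C]_(n.+1, p)) (c : 'cV[C]_p) : S s ->
  (forall j, real_span S (col j X)) -> (forall j, c j 0 \is Num.real) -> real_span S (X *m c).
Proof.
move=> Ss rX cr; have -> : X *m c = \sum_j c j 0 *: col j X.
  by apply/colP=> i; rewrite mxE summxE; apply: eq_bigr => j _; rewrite !mxE mulrC.
elim/big_ind: _ => [|x y|j _]; first exact: real_span0 Ss.
  exact: real_spanD.
exact: real_spanZ Ss (cr j) (rX j).
Qed.

Lemma real_span_ip S x y : (forall s t, S s -> S t -> ip s t \is Num.real) ->
  real_span S x -> real_span S y -> ip x y \is Num.real.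
Proof.
move=> Sr; elim=> [s Ss|a x1 x2 ar _ IH1 _ IH2] ry; last first.
  by rewrite ipDl ipZl rpredD ?rpredM ?IH1 ?IH2 //; have /CrealP -> := ar.
elim: ry => [t St|a y1 y2 ar _ IH1 _ IH2]; first exact: Sr.
by rewrite ipDr ipZr rpredD ?rpredM ?IH1 ?IH2.
Qed.

Lemma real_span_stable (S : V -> Prop) (g : M) x :
  (forall s, S s -> S (g *m s)) -> real_span S x -> real_span S (g *m x).
Proof.
move=> gS; elim=> [s Ss|a x1 x2 ar _ IH1 _ IH2]; first exact/real_span_gen/gS.
by rewrite mulmxDr -scalemxAr; apply: real_span_comb.
Qed.

(** The last column is the negative vector, all others are positive. *)
Definition orthoframe p (X : 'M[C]_(n.+1, p.+1)) : Prop :=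
  hadj X *m J *m X = Jform R p.

Lemma orthoframe_leq p (X : 'M[C]_(n.+1, p.+1)) : orthoframe X -> (p <= n)%N.
Proof.
move=> Xo; rewrite -ltnS; apply: (@mulmx1_min _ _ _ (Jform R p *m hadj X *m J) X).
by rewrite -!mulmxA (mulmxA (hadj X)) [X in _ *m X]Xo Jform_involutive.
Qed.

(** The new positive vector goes in front, so that the negative one stays last. *)
Lemma orthoframe_extend p (X : 'M[C]_(n.+1, p.+1)) (r : V) : orthoframe X ->
  hadj X *m J *m r = 0 -> ip r r = 1 ->
  orthoframe (row_mx r X : 'M_(n.+1, 1 + p.+1)).
Proof.
move=> Xo Xr rr.
suff H : hadj (row_mx r X) *m J *m row_mx r X = block_mx (1%:M : 'M_1) 0 0 (Jform R p).
  by rewrite /orthoframe Jform_block.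
rewrite hadj_row_mx mul_col_mx mul_col_row Xr [hadj X *m _ *m X]Xo.
congr block_mx; first by rewrite ip_mx rr.
by apply: (can_inj (@hadjK _ _ _)); rewrite hadj0 !hadjM hadjK hadj_Jform mulmxA.
Qed.

Lemma gram_pair (x y : V) : hadj (row_mx x y) *m J *m row_mx x y =
  block_mx (ip x x)%:M (ip x y)%:M (ip y x)%:M (ip y y)%:M.
Proof. by rewrite hadj_row_mx mul_col_mx mul_col_row !ip_mx. Qed.

(** The vectors [v + u] and [v - u] have squares 2 and -2. *)
Definition standard_frame (v u : V) : 'M[C]_(n.+1, 2) :=
  row_mx ((sqrtC 2%:R)^-1 *: (v + u)) ((sqrtC 2%:R)^-1 *: (v - u)) : 'M_(n.+1, 1 + 1).

Lemma sqrtC2_real : (sqrtC 2%:R : C)^-1 \is Num.real.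
Proof. by rewrite rpredV ger0_real // sqrtC_ge0. Qed.

Lemma half_sqrtC2 : (sqrtC 2%:R : C)^-1 * (sqrtC 2%:R)^-1 = 2%:R^-1.
Proof. by rewrite -expr2 exprVn sqrtCK. Qed.

Lemma standard_frame_ortho v u : hyperbolic_pair v u -> orthoframe (standard_frame v u).
Proof.
rewrite /standard_frame => -[vv uu uv]; have vu : ip v u = 1 by rewrite ipC uv conjC1.
have kc : ((sqrtC 2%:R : C)^-1)^* = (sqrtC 2%:R)^-1 by apply/CrealP/sqrtC2_real.
have two : (2%:R : C) != 0 by rewrite pnatr_eq0.
set x := _ *: (v + u); set y := _ *: (v - u).
suff H : hadj (row_mx x y) *m J *m row_mx x y = block_mx (1%:M : 'M_1) 0 0 (Jform R 0).
  by rewrite /orthoframe Jform_block.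
rewrite gram_pair; congr block_mx; rewrite /x /y.
- by rewrite ipZr ipZl kc mulrA half_sqrtC2 !ip_lin vv uu uv vu; congr _%:M; field.
- by rewrite ipZr ipZl !ip_lin vv uu uv vu; apply/matrixP=> i j; rewrite !ord1 !mxE mulr1n; ring.
- by rewrite ipZr ipZl !ip_lin vv uu uv vu; apply/matrixP=> i j; rewrite !ord1 !mxE mulr1n; ring.
- rewrite ipZr ipZl kc mulrA half_sqrtC2 !ip_lin vv uu uv vu.
  by apply/matrixP=> i j; rewrite !ord1 !mxE !eqxx !mulr1n; field.
Qed.

Lemma standard_frame_span v u : exists a b : 'cV[C]_2,
  v = standard_frame v u *m a /\ u = standard_frame v u *m b.
Proof.
have s0 : (sqrtC 2%:R : C) != 0 by rewrite sqrtC_eq0 pnatr_eq0.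
have two : (2%:R : C) != 0 by rewrite pnatr_eq0.
pose k : C := (sqrtC 2%:R) / 2%:R.
exists (col_mx k%:M k%:M : 'cV_(1 + 1)), (col_mx k%:M (- k)%:M : 'cV_(1 + 1)).
have H (x y : V) (c d : C) : row_mx x y *m col_mx c%:M d%:M = c *: x + d *: y.
  by rewrite mul_row_col !mul_mx_scalar.
have k1 : k * (sqrtC 2%:R)^-1 = 2%:R^-1 by rewrite /k; field; rewrite ?s0 ?two.
have k2 : - k * (sqrtC 2%:R)^-1 = - 2%:R^-1 by rewrite mulNr k1.
split; apply: (etrans _ (esym (H _ _ _ _))); rewrite !scalerA k1 ?k2;
  by apply/colP=> i; rewrite !mxE; field.
Qed.

(** As [v] and [u] lie in the span of [X], a vector orthogonal to [X] is orthogonal to both and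
    hence positive; its normalising factor is real, so the new column stays in the real span. *)
Lemma real_frame_extend (S : V -> Prop) (s0 v u r : V) p (X : 'M[C]_(n.+1, p.+1)) :
  hyperbolic_pair v u -> S s0 -> orthoframe X -> (forall j, real_span S (col j X)) ->
  (exists a b, v = X *m a /\ u = X *m b) ->
  real_span S r -> hadj X *m J *m r = 0 -> r != 0 ->
  exists Y : 'M[C]_(n.+1, p.+2), [/\ orthoframe Y, forall j, real_span S (col j Y) &
    exists a b, v = Y *m a /\ u = Y *m b].
Proof.
move=> hyp Ss0 Xo rX vuX rr Xr r0.
have orth w a : w = X *m a -> ip w r = 0.
  by move=> ->; rewrite /ip hadjM -!mulmxA (mulmxA (hadj X)) Xr mulmx0 mxE.
have [a [b [va ub]]] := vuX; have [vv uu uv] := hyp.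
have vr := orth _ _ va; have ur := orth _ _ ub.
have pos : 0 < ip r r.
  rewrite lt0r (null_orth_ge0 vv (hyperbolic_pair_neq0 hyp)) // andbT.
  by apply: contra_neq r0 => /(orth_pair_eq0 hyp vr ur).
have q0 : 0 < sqrtC (ip r r) by rewrite sqrtC_gt0.
pose r' := (sqrtC (ip r r))^-1 *: r.
have q'r : (sqrtC (ip r r))^-1 \is Num.real by rewrite rpredV gtr0_real.
have r'r : real_span S r' by exact: (real_spanZ Ss0).
have Xo' : orthoframe (row_mx r' X : 'M_(n.+1, 1 + p.+1)).
  apply: orthoframe_extend => //; rewrite /r'.
    by rewrite -scalemxAr Xr scaler0.
  rewrite !ip_lin; have /CrealP -> := q'r.
  by rewrite mulrA -invfM -expr2 sqrtCK mulVf // gt_eqF.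
exists (row_mx r' X : 'M_(n.+1, 1 + p.+1)); split=> //.
- have cols (j : 'I_(1 + p.+1)) : real_span S (col j (row_mx r' X)).
    case: (split_ordP j) => j' ->; last by rewrite colKr.
    rewrite colKl; have -> // : col j' r' = r' by apply/colP=> i; rewrite mxE ord1.
  exact: cols.
- exists (col_mx 0 a : 'cV_(1 + p.+1)), (col_mx 0 b : 'cV_(1 + p.+1)).
  have H (d : 'cV_p.+1) : row_mx r' X *m col_mx 0 d = X *m d by rewrite mul_row_col mulmx0 add0r.
  by split; [rewrite va; apply: esym; exact: H | rewrite ub; apply: esym; exact: H].
Qed.

(* A vector of [S] outside the span of [X] yields, after projection, a longer
   orthonormal family; the length is bounded by [orthoframe_leq]. *)
Lemma real_gram_schmidt (S : V -> Prop) (v u : V) p (X : 'M[C]_(n.+1, p.+1)) :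
  hyperbolic_pair v u -> (exists s, S s) ->
  (forall s t, S s -> S t -> ip s t \is Num.real) ->
  orthoframe X -> (forall j, real_span S (col j X)) ->
  (exists a b, v = X *m a /\ u = X *m b) ->
  exists q (Y : 'M[C]_(n.+1, q.+1)), [/\ (p <= q)%N, orthoframe Y,
    forall j, real_span S (col j Y), exists a b, v = Y *m a /\ u = Y *m b &
    forall s, S s -> s = Y *m (Jform R q *m hadj Y *m J *m s)].
Proof.
move=> hyp [s0 Ss0] Sr.
(* Induction on the codimension left to the frame. *)
have [k le_k] := ubnP (n - p); elim: k p X le_k => // k IH p X le_k Xo rX vuX.
have [full|/existsNP[s /not_implyP[Ss ns]]] :=
  pselect (forall s, S s -> s = X *m (Jform R p *m hadj X *m J *m s)).
  by exists p, X; split.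
have XJs i j : (hadj X *m J *m s) i j \is Num.real.
  rewrite gramE; apply: (real_span_ip Sr (rX _)).
  have -> : col j s = s by apply/colP=> k0; rewrite mxE ord1.
  exact: real_span_gen.
set c := Jform R p *m hadj X *m J *m s in ns.
pose r := s - X *m c.
have r0 : r != 0 by rewrite subr_eq0; apply/eqP.
have rr : real_span S r.
  apply: (real_spanB Ss0 (real_span_gen Ss)); apply: (real_span_mulmx Ss0 rX) => j.
  rewrite /c -!mulmxA; apply: real_mulmx; first exact: Jform_real.
  by move=> i j'; rewrite mulmxA.
have Xr : hadj X *m J *m r = 0.
  rewrite /r /c mulmxBr !mulmxA [hadj X *m J *m X]Xo Jform_involutive mul1mx subrr //.
have [X' [Xo' rX' vuX']] := real_frame_extend hyp Ss0 Xo rX vuX rr Xr r0.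
have lt_pn := orthoframe_leq Xo'.
have [|q [Y [pq Yo rY vuY cY]]] := IH _ X' _ Xo' rX' vuX'.
  by move: le_k; rewrite ltnS => /(leq_trans _); apply; rewrite ltn_sub2l.
by exists q, Y; split=> //; apply: leq_trans pq.
Qed.
End Frames.

(** * Matrix products along equalities of dimensions *)

Section Casts.
Variable K : comNzRingType.

Lemma mulmx_cast_col (p q r s : nat) (e : r = s) (A : 'M[K]_(p, q)) (B : 'M[K]_(q, r)) :
  A *m castmx (erefl, e) B = castmx (erefl, e) (A *m B).
Proof. by case: s / e; rewrite !castmx_id. Qed.

Lemma mulmx_cast_row_col (p q s : nat) (e : p = s) (A : 'M[K]_(p, q)) (B : 'M[K]_(q, p)) :
  castmx (e, erefl) A *m castmx (erefl, e) B = castmx (e, e) (A *m B).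
Proof. by case: s / e; rewrite !castmx_id. Qed.

Lemma mulmx_cast_inner (p q r s : nat) (e : q = s) (A : 'M[K]_(p, q)) (B : 'M[K]_(q, r)) :
  castmx (erefl, e) A *m castmx (e, erefl) B = A *m B.
Proof. by case: s / e; rewrite !castmx_id. Qed.

Lemma mulmx_cast_both (p q s : nat) (e : q = s) (A : 'M[K]_(p, q)) (B : 'M[K]_(q, q)) :
  castmx (erefl, e) A *m castmx (e, e) B = castmx (erefl, e) (A *m B).
Proof. by case: s / e; rewrite !castmx_id. Qed.

Lemma det_cast (p q : nat) (e : p = q) (A : 'M[K]_p) : \det (castmx (e, e) A) = \det A.
Proof. by case: q / e; rewrite castmx_id. Qed.
End Casts.

(** * Block decomposition along an invariant frame *)

Section Splitting.
Variables (R : realType) (n : nat).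
Local Notation C := R[i].
Local Notation J := (Jform R n).
Local Notation V := 'cV[C]_n.+1.
Local Notation M := 'M[C]_n.+1.

Lemma hadj_cast (p q s : nat) (e : q = s) (A : 'M[C]_(p, q)) :
  hadj (castmx (erefl, e) A) = castmx (e, erefl) (hadj A).
Proof. by case: s / e; rewrite !castmx_id. Qed.

Lemma exists_kernel_vector p q (A : 'M[C]_(p, q)) : (p < q)%N ->
  exists2 x : 'cV[C]_q, A *m x = 0 & x != 0.
Proof.
move=> pq; have cn0 : cokermx A != 0.
  by rewrite -mxrank_eq0 mxrank_coker subn_eq0 -ltnNge (leq_ltn_trans (rank_leq_row A)).
have [j cj] : exists j, col j (cokermx A) != 0.
  apply: contrapT => none; move/eqP: cn0; apply; apply/matrixP=> i j; rewrite [RHS]mxE.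
  have : col j (cokermx A) = 0 by apply/eqP/negPn/negP => h; apply: none; exists j.
  by move/matrixP => /(_ i 0); rewrite !mxE.
by exists (col j (cokermx A)); rewrite // colE mulmxA mulmx_coker mul0mx.
Qed.

(** At each stage [Y] and [X] impose at most [n] linear conditions in dimension [n.+1]. A nonzero
    solution is orthogonal to [v] and [u], hence positive, and can be normalised. *)
Lemma orthocomplement_frame p (X : 'M[C]_(n.+1, p.+1)) (v u : V) k :
  hyperbolic_pair v u -> orthoframe X -> (exists a b, v = X *m a /\ u = X *m b) ->
  (k + p <= n)%N ->
  exists Y : 'M[C]_(n.+1, k), hadj Y *m J *m Y = 1%:M /\ hadj Y *m J *m X = 0.
Proof.
move=> hyp Xo [a [b [va ub]]]; elim: k => [|k IH] le_kp.
  by exists 0; split; apply/matrixP=> -[].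
have [Y [YY YX]] := IH (ltnW le_kp).
have [r Dr r0] : exists2 r : V, hadj (row_mx Y X) *m J *m r = 0 & r != 0.
  by apply: exists_kernel_vector; rewrite addnS ltnS.
move: Dr; rewrite hadj_row_mx !mul_col_mx => /eqP; rewrite col_mx_eq0 => /andP[/eqP Yr /eqP Xr].
have orth w c : w = X *m c -> ip w r = 0.
  by move=> ->; rewrite /ip hadjM -!mulmxA (mulmxA (hadj X)) Xr mulmx0 mxE.
have [vv uu uv] := hyp; have vr := orth _ _ va; have ur := orth _ _ ub.
have pos : 0 < ip r r.
  rewrite lt0r (null_orth_ge0 vv (hyperbolic_pair_neq0 hyp)) // andbT.
  by apply: contra_neq r0 => /(orth_pair_eq0 hyp vr ur).
have q0 : 0 < sqrtC (ip r r) by rewrite sqrtC_gt0.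
pose s := (sqrtC (ip r r))^-1 *: r.
have ss : ip s s = 1.
  rewrite !ip_lin; have /CrealP -> : (sqrtC (ip r r))^-1 \is Num.real by rewrite rpredV gtr0_real.
  by rewrite mulrA -invfM -expr2 sqrtCK mulVf // gt_eqF.
have Ys : hadj Y *m J *m s = 0 by rewrite -scalemxAr Yr scaler0.
have Xs : hadj X *m J *m s = 0 by rewrite -scalemxAr Xr scaler0.
have adj q (Z : 'M[C]_(n.+1, q)) : hadj Z *m J *m s = 0 -> hadj s *m J *m Z = 0.
  by move=> Zs; apply: (can_inj (@hadjK _ _ _)); rewrite hadj0 !hadjM hadjK hadj_Jform mulmxA.
exists (row_mx s Y : 'M_(n.+1, 1 + k)); split.
  suff : hadj (row_mx s Y) *m J *m row_mx s Y = 1%:M by [].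
  by rewrite hadj_row_mx mul_col_mx mul_col_row YY Ys (adj _ _ Ys) ip_mx ss -scalar_mx_block.
suff : hadj (row_mx s Y) *m J *m X = 0 by [].
by rewrite hadj_row_mx !mul_col_mx YX (adj _ _ Xs) col_mx0.
Qed.

Lemma Jform_cast k p (e : (k + p.+1 = n.+1)%N) :
  J = castmx (e, e) (block_mx 1%:M 0 0 (Jform R p)).
Proof.
apply/matrixP=> i j; rewrite castmxE [LHS]mxE [X in X *+ _]mxE.
set i' := cast_ord _ i; set j' := cast_ord _ j.
have vi : val i = val i' by []. have vj : val j = val j' by [].
have last_i : (i == ord_max) = (val i' == k + p :> nat)%N.
  by rewrite -val_eqE /= vi; congr (_ == _); apply: succn_inj; rewrite -addnS e.
rewrite last_i -(inj_eq val_inj i j) vi vj; clearbody i' j'; clear -R.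
case: (split_ordP i') => a ->; case: (split_ordP j') => b ->;
  rewrite ?block_mxEul ?block_mxEur ?block_mxEdl ?block_mxEdr !mxE /=.
- by have -> : (a == k + p :> nat)%N = false by apply/ltn_eqF/(leq_trans (ltn_ord a))/leq_addr.
- by have -> : (a == k + b :> nat)%N = false by apply/ltn_eqF/(leq_trans (ltn_ord a))/leq_addr.
- have -> // : (k + a == b :> nat)%N = false.
  by rewrite eq_sym; apply/ltn_eqF/(leq_trans (ltn_ord b))/leq_addr.
- by rewrite !eqn_add2l -!val_eqE /=.
Qed.

Variable Gam : M -> Prop.
Hypothesis sub : is_subgroup_SU_n1 Gam.
Let Gp g : Gam g -> preserves g.
Proof. exact: (Gam_preserves sub). Qed.
Let Gam_inv g : Gam g -> Gam (invmx g).
Proof. by case: sub => _ [_ [H _]]; exact: H. Qed.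

(** Completing [X] to an orthonormal basis gives the conjugating matrix. The predicate [P] carries
    what distinguishes the two conclusions: real entries of [B], or determinant 1. *)
Lemma block_conjugation p k (e : (k + p.+1 = n.+1)%N) (X : 'M[C]_(n.+1, p.+1)) (v u : V)
    (P : 'M[C]_p.+1 -> Prop) :
  hyperbolic_pair v u -> orthoframe X -> (exists a b, v = X *m a /\ u = X *m b) ->
  (forall g, Gam g -> exists2 B, g *m X = X *m B & P B) ->
  exists h, inSU_n1 h /\ forall g, Gam g -> exists (A : 'M[C]_k) (B : 'M[C]_p.+1),
    [/\ inU A, hadj B *m Jform R p *m B = Jform R p, P B, \det A * \det B = 1 &
      invmx h *m g *m h = castmx (e, e) (block_mx A 0 0 B)].
Proof.
move=> hyp Xo vuX stab.
have kp : (k + p <= n)%N by rewrite -ltnS -addnS e.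
have [Y [YY YX]] := orthocomplement_frame hyp Xo vuX kp.
have XY : hadj X *m J *m Y = 0.
  by apply: (can_inj (@hadjK _ _ _)); rewrite hadj0 !hadjM hadjK hadj_Jform mulmxA.
pose W := row_mx Y X; pose T : M := castmx (erefl, e) W.
have WW : hadj W *m J *m W = block_mx 1%:M 0 0 (Jform R p).
  by rewrite /W hadj_row_mx mul_col_mx mul_col_row YY YX XY [hadj X *m _ *m X]Xo.
have hadjT : hadj T = castmx (e, erefl) (hadj W).
  exact: hadj_cast.
have Tp : preserves T.
  rewrite /preserves hadjT /T -mulmxA mulmx_cast_col mulmx_cast_row_col mulmxA WW.
  by rewrite -Jform_cast.
have complete q (Z : 'M[C]_(n.+1, q)) :
    Z = Y *m (hadj Y *m J *m Z) + X *m (Jform R p *m (hadj X *m J *m Z)).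
  have TT : T *m J *m hadj T = Y *m hadj Y + X *m Jform R p *m hadj X.
    rewrite (Jform_cast e) hadjT /T mulmx_cast_both mulmx_cast_inner /W hadj_row_mx.
    by rewrite mul_row_block !mulmx0 mulmx1 addr0 add0r mul_row_col.
  rewrite -[LHS]mul1mx -(mulmxV (preserves_unit Tp)) preserves_inv // !mulmxA TT.
  by rewrite !mulmxDl.
have detT : `|\det T| = 1.
  have := congr1 determinant Tp; rewrite !det_mulmx det_hadj mulrAC -normCKC.
  have J0 : \det J != 0.
    by have := Jform_involutive R n => /mulmx1_unit[]; rewrite unitmxE unitfE.
  move=> /(canRL (mulfK J0)); rewrite divff // => /eqP; rewrite sqrp_eq1 //.
  by move/eqP.
have T0 : \det T != 0 by rewrite -normr_eq0 detT oner_eq0.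
(* A scalar of modulus 1 that brings the determinant to 1, keeps the form and cancels in the
   conjugation. *)
pose mu : C := n.+1.-root ((\det T)^-1).
have muX : mu ^+ n.+1 = (\det T)^-1 by rewrite rootCK.
have mu1 : `|mu| = 1.
  have : `|mu| ^+ n.+1 = 1 by rewrite -normrX muX normfV detT invr1.
  by move/eqP; rewrite pexpr_eq1 // => /eqP.
have mu0 : mu != 0 by rewrite -normr_eq0 mu1 oner_eq0.
have hp : preserves (mu *: T).
  rewrite /preserves hadjZ -!scalemxAl -scalemxAr scalerA [_ * mu]mulrC -normCK mu1 expr1n scale1r.
  exact: Tp.
exists (mu *: T); split; first by split=> //; rewrite detZ muX mulVf.
move=> g Gg; have [B gB PB] := stab g Gg; have [B' gB' _] := stab _ (Gam_inv Gg).
have gp := Gp Gg.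
pose A := hadj Y *m J *m g *m Y.
have YgX : hadj Y *m J *m g *m X = 0 by rewrite -mulmxA gB mulmxA YX mul0mx.
(* The inverse of [g] also keeps the span of [X], so [g] keeps its complement. *)
have XgY : hadj X *m J *m g *m Y = 0.
  have -> : hadj X *m J *m g = hadj (invmx g *m X) *m J.
    by rewrite preserves_inv // !hadjM hadjK !hadj_Jform !mulmxA -!mulmxA Jform_involutive mulmx1.
  by rewrite gB' hadjM -!mulmxA (mulmxA (hadj X)) XY mulmx0.
have gY : g *m Y = Y *m A.
  by rewrite [LHS]complete (mulmxA _ g Y) (mulmxA _ g Y) XgY !mulmx0 addr0.
have gT : g *m T = T *m castmx (e, e) (block_mx A 0 0 B).
  by rewrite /T mulmx_cast_col mulmx_cast_both /W mul_mx_row mul_row_block gY gB !mulmx0 addr0 add0r.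
have conjE : invmx (mu *: T) *m g *m (mu *: T) = castmx (e, e) (block_mx A 0 0 B).
  have hU := preserves_unit hp.
  by rewrite -mulmxA -scalemxAr gT scalemxAl mulKmx.
exists A, B; split=> //.
- have : hadj (g *m Y) *m J *m (g *m Y) = 1%:M.
    by rewrite hadjM -[RHS]YY -[in RHS]gp !mulmxA.
  have -> : hadj (g *m Y) *m J *m (g *m Y) = hadj A *m (hadj Y *m J *m Y) *m A.
    by rewrite gY hadjM !mulmxA.
  by rewrite YY mulmx1.
- have : hadj (g *m X) *m J *m (g *m X) = Jform R p.
    by rewrite hadjM -[RHS]Xo -[in RHS]gp !mulmxA.
  have -> : hadj (g *m X) *m J *m (g *m X) = hadj B *m (hadj X *m J *m X) *m B.
    by rewrite gB hadjM !mulmxA.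
  by rewrite [hadj X *m _ *m X]Xo.
- rewrite -(det_ublock _ 0) -(det_cast e) -conjE !det_mulmx mulrAC -det_mulmx mulVmx ?preserves_unit //.
  by rewrite det1 mul1r; case: sub => _ [_ [_ H]]; have [] := H g Gg.
Qed.
End Splitting.

(** * The two cases *)
Section Dichotomy.
Variables (R : realType) (n : nat).
Local Notation C := R[i].
Local Notation J := (Jform R n).
Local Notation V := 'cV[C]_n.+1.
Local Notation M := 'M[C]_n.+1.

Lemma real_span_coordinates S q (Y : 'M[C]_(n.+1, q.+1)) x :
  (forall s, S s -> s = Y *m (Jform R q *m hadj Y *m J *m s)) ->
  real_span S x -> x = Y *m (Jform R q *m hadj Y *m J *m x).
Proof.
move=> cS; elim=> [s|a y z _ _ IHy _ IHz]; first exact: cS.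
by rewrite {1}IHy {1}IHz !mulmxDr -!scalemxAr.
Qed.

(** The coordinates of [g *m Y] are, up to signs, pairings of vectors of the real span. *)
Lemma real_span_frame_action S (g : M) q (Y : 'M[C]_(n.+1, q.+1)) :
  (forall s t, S s -> S t -> ip s t \is Num.real) -> (forall s, S s -> S (g *m s)) ->
  (forall j, real_span S (col j Y)) ->
  (forall s, S s -> s = Y *m (Jform R q *m hadj Y *m J *m s)) ->
  exists2 B, g *m Y = Y *m B & forall i j, B i j \is Num.real.
Proof.
move=> Sr gS rY cY; exists (Jform R q *m (hadj Y *m J *m (g *m Y))).
  apply/matrixP=> i j; have rj := real_span_stable gS (rY j).
  have := congr1 (fun x : V => x i 0) (real_span_coordinates cY rj).
  by rewrite /= !colE !mulmxA -!colE [LHS]mxE [RHS]mxE.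
apply: real_mulmx; first exact: Jform_real.
move=> i j; rewrite gramE; apply: (real_span_ip Sr) => //.
have -> : col j (g *m Y) = g *m col j Y by rewrite !colE mulmxA.
exact: real_span_stable.
Qed.

Lemma hyperbolic_plane_action (g : M) (v u : V) : hyperbolic_pair v u -> preserves g ->
  g *m v = ip u (g *m v) *: v + ip v (g *m v) *: u ->
  g *m u = ip u (g *m u) *: v + ip v (g *m u) *: u ->
  let a := ip u (g *m v) in let b := ip v (g *m v) in
  let c := ip u (g *m u) in let d := ip v (g *m u) in
  a^* * b + b^* * a = 0 /\ c^* * b + d^* * a = 1 /\ c^* * d + d^* * c = 0.
Proof.
move=> [vv uu uv] gp gv gu a b c d; have vu : ip v u = 1 by rewrite ipC uv conjC1.
split; last split.
- rewrite -[RHS]vv -(preserves_ip v v gp) gv -/a -/b !ip_lin vv uu uv vu; ring.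
- rewrite -[RHS]uv -(preserves_ip u v gp) gv gu -/a -/b -/c -/d !ip_lin vv uu uv vu; ring.
- rewrite -[RHS]uu -(preserves_ip u u gp) gu -/c -/d !ip_lin vv uu uv vu; ring.
Qed.

Lemma det_mx2 (K : comNzRingType) (a b c d : K) :
  \det (block_mx a%:M b%:M c%:M d%:M : 'M_(1 + 1)) = a * d - b * c.
Proof.
have l1 : @lift (1 + 1) (lshift 1 (ord0 : 'I_1)) (ord0 : 'I_1) = rshift 1 (ord0 : 'I_1).
  exact: val_inj.
have l2 : @lift (1 + 1) (rshift 1 (ord0 : 'I_1)) (ord0 : 'I_1) = lshift 1 (ord0 : 'I_1).
  exact: val_inj.
have detE (A : 'M[K]_(1 + 1)) : \det A =
    A (lshift 1 ord0) (lshift 1 ord0) * A (rshift 1 ord0) (rshift 1 ord0)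
    - A (lshift 1 ord0) (rshift 1 ord0) * A (rshift 1 ord0) (lshift 1 ord0).
  rewrite (expand_det_row _ (lshift 1 0)) big_split_ord !big_ord1 /= /cofactor !det_mx11.
  by rewrite ![in LHS]mxE l1 l2 /=; ring.
by rewrite detE block_mxEul block_mxEur block_mxEdl block_mxEdr !mxE /= !mulr1n.
Qed.

Lemma hyperbolic_plane_frame (g : M) (v u : V) a b c d :
  g *m v = a *: v + b *: u -> g *m u = c *: v + d *: u ->
  exists2 B, g *m standard_frame v u = standard_frame v u *m B & \det B = a * d - c * b.
Proof.
move=> gv gu; pose k : C := (sqrtC 2%:R)^-1.
(* The involution exchanging the basis [v], [u] with the standard frame; conjugating by it preserves
   the determinant. *)
pose H : 'M[C]_(1 + 1) := k *: block_mx 1%:M 1%:M 1%:M (- 1)%:M.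
pose T : 'M[C]_(1 + 1) := block_mx a%:M c%:M b%:M d%:M.
have HH : H *m H = 1%:M.
  rewrite /H -scalemxAl -scalemxAr scalerA half_sqrtC2 mulmx_block !mul1mx !mulmx1.
  have two : (2%:R : C) != 0 by rewrite pnatr_eq0.
  apply/matrixP=> i j; case: (split_ordP i) => i' ->; case: (split_ordP j) => j' ->;
    rewrite mxE ?block_mxEul ?block_mxEur ?block_mxEdl ?block_mxEdr -?scalar_mxM !ord1 !mxE /=;
    by rewrite ?mulr1n ?mulr0n; field.
have XE : standard_frame v u = row_mx v u *m H.
  rewrite /H -scalemxAr mul_row_block !mulmx1 mul_mx_scalar scaleN1r.
  by rewrite scale_row_mx.
have DT : g *m row_mx v u = row_mx v u *m T.
  by rewrite mul_mx_row mul_row_block !mul_mx_scalar gv gu.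
exists (H *m T *m H).
  by rewrite XE mulmxA DT !mulmxA -(mulmxA _ H H) HH mulmx1.
by rewrite det_mulmx det_mulmx mulrAC -det_mulmx HH det1 mul1r det_mx2.
Qed.

Lemma standard_frame_col (v u : V) j :
  col j (standard_frame v u) = (sqrtC 2%:R)^-1 *: (v + u) \/
  col j (standard_frame v u) = (sqrtC 2%:R)^-1 *: (v - u).
Proof.
rewrite /standard_frame; set x := _ *: (v + u); set y := _ *: (v - u).
suff H (i : 'I_(1 + 1)) : col i (row_mx x y) = x \/ col i (row_mx x y) = y by exact: H.
case: (split_ordP i) => i' ->; rewrite ?colKl ?colKr; [left|right];
  by apply/colP=> l; rewrite mxE ord1.
Qed.

Variable Gam : M -> Prop.
Hypothesis sub : is_subgroup_SU_n1 Gam.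
Hypothesis disc : discrete_set Gam.
Hypothesis nonelem : nonelementary Gam.
Hypothesis trace_real : forall g, Gam g -> \tr g \is Num.real.

(** The split is on whether the orbit [S] of [v] and [u] stays in their complex span; each side then
    forces the sign [e]. *)
Lemma real_trace_dichotomy :
  (exists m : nat, (2 <= m)%N /\ conj_into Gam (inSUO m)) \/
  conj_into Gam (@inSU_SU11 R n).
Proof.
have Gp := Gam_preserves sub.
have Gam_mul g g' : Gam g -> Gam g' -> Gam (g *m g') by case: sub => _ [H _]; exact: H.
have Gam_inv g : Gam g -> Gam (invmx g) by case: sub => _ [_ [H _]]; exact: H.
have Gam_1 : Gam 1%:M by case: sub.
have [h [v [u [lam [Gh lox]]]]] := nonelementary_loxodromic sub nonelem.
have [_ _ _ _ hyp] := lox.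
have [vv uu uv] := hyp; have vu : ip v u = 1 by rewrite ipC uv conjC1.
have [e [e1 eGam]] := self_pairing_sign sub disc nonelem trace_real Gh lox.
have cr := cross_real sub trace_real Gh lox.
have cr' := cross_real' sub trace_real Gh lox.
have Xo := standard_frame_ortho hyp.
have vuX := standard_frame_span v u.
have n1 := orthoframe_leq Xo.
pose S s := exists2 g, Gam g & s = g *m v \/ s = g *m u.
have Sv : S v by exists 1%:M => //; left; rewrite mul1mx.
have Su : S u by exists 1%:M => //; right; rewrite mul1mx.
have [plane|/existsNP[s /not_implyP[Ss ns]]] :=
  pselect (forall s, S s -> s = ip u s *: v + ip v s *: u).
  have gv g : Gam g -> g *m v = ip u (g *m v) *: v + ip v (g *m v) *: u.
    by move=> Gg; apply: plane; exists g => //; left.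
  have gu g : Gam g -> g *m u = ip u (g *m u) *: v + ip v (g *m u) *: u.
    by move=> Gg; apply: plane; exists g => //; right.
  have act g Gg := hyperbolic_plane_action hyp (Gp g Gg) (gv g Gg) (gu g Gg).
  case: e1 => e1; rewrite {}e1 in eGam.
    (* Real coefficients turn the isometry relations into [a * b = 0] and [c * d = 0]; with
       [c * b + d * a = 1] only a diagonal or antidiagonal action remains. *)
    exfalso; apply: (not_permuting_pair sub nonelem hyp) => g Gg.
    have [/= ab [cb cd]] := act g Gg; have [bE cE] := eGam g Gg; rewrite mul1r in bE; rewrite mul1r in cE.
    have /CrealP aE := cr g Gg; have /CrealP dE := cr' g Gg.
    move: ab cb cd (gv g Gg) (gu g Gg); rewrite aE bE cE dE.
    move: (ip u (g *m v)) (ip v (g *m v)) (ip u (g *m u)) (ip v (g *m u)) => a b c d ab cb cd gvE guE.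
    have half (x y : C) : x * y + y * x = 0 -> x * y = 0.
      have two : (2%:R : C) != 0 by rewrite pnatr_eq0.
      by move=> xy; apply: (mulfI two); rewrite mulr0 -[RHS]xy; ring.
    have cd0 := half _ _ cd; have /eqP := half _ _ ab.
    rewrite mulf_eq0 => /orP[] /eqP z0; move: cb gvE guE; rewrite z0.
      rewrite mulr0 addr0 scale0r add0r => cb gvE guE; right; exists b, c; split=> //.
      have d0 : d = 0.
        apply/eqP; move/eqP: cd0; rewrite mulf_eq0 => /orP[/eqP c0|//].
        by move: cb; rewrite c0 mul0r => /eqP; rewrite eq_sym oner_eq0.
      by rewrite guE d0 scale0r addr0.
    rewrite mulr0 add0r scale0r addr0 => cb gvE guE; left; exists a, d; split=> //.
    have c0 : c = 0.
      apply/eqP; move/eqP: cd0; rewrite mulf_eq0 => /orP[//|/eqP d0].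
      by move: cb; rewrite d0 mul0r => /eqP; rewrite eq_sym oner_eq0.
    by rewrite guE c0 scale0r add0r.
  right.
  have stab g : Gam g -> exists2 B, g *m standard_frame v u = standard_frame v u *m B & \det B = 1.
    move=> Gg; have [B gB dB] := hyperbolic_plane_frame (gv g Gg) (gu g Gg).
    (* With [e = -1] the isometry relation [c^* * b + d^* * a = 1] reads [a * d - c * b = 1]. *)
    exists B; rewrite // dB; have [/= _ [<- _]] := act g Gg.
    have [bE cE] := eGam g Gg; have /CrealP dE := cr' g Gg.
    rewrite dE cE; move: (ip u (g *m v)) (ip v (g *m v)) (ip u (g *m u)) (ip v (g *m u)).
    by move=> *; ring.
  have e11 : (n.-1 + 2 = n.+1)%N by rewrite addn2 prednK.
  have [k [ks kG]] := block_conjugation sub e11 hyp Xo vuX stab.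
  exists k; split=> // g Gg; have [A [B [UA UB dB dAB gE]]] := kG g Gg.
  exists e11, A, B; split; first by split=> //; move: dAB; rewrite dB mulr1.
  by split.
have real_pairing : e = 1.
  case: e1 => // em; exfalso; apply: ns; have [g Gg sE] := Ss.
  have [ev eu] := eGam g Gg; rewrite em mulN1r in ev; rewrite em mulN1r in eu.
  have [gvE guE] := antireal_orbit_decomposition sub trace_real Gh lox Gg ev eu.
  by case: sE => ->.
rewrite {e e1}real_pairing in eGam.
left.
have Sr s' t : S s' -> S t -> ip s' t \is Num.real.
  have key g : Gam g -> [/\ ip v (g *m v) \is Num.real, ip v (g *m u) \is Num.real,
      ip u (g *m v) \is Num.real & ip u (g *m u) \is Num.real].
    by move=> Gg; have [] := eGam g Gg; rewrite !mul1r => /CrealP ? /CrealP ?; split; auto.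
  move=> [g Gg s'E] [g' Gg' tE].
  have [r1 r2 r3 r4] := key _ (Gam_mul _ _ (Gam_inv _ Gg) Gg').
  have mv x y : ip (g *m x) (g' *m y) = ip x (invmx g *m g' *m y).
    by rewrite (preserves_ipl _ _ (Gp _ Gg)) mulmxA.
  case: s'E => ->; case: tE => ->; rewrite mv; [exact: r1|exact: r2|exact: r3|exact: r4].
have gS g t : Gam g -> S t -> S (g *m t).
  by move=> Gg [g' Gg' [] ->]; exists (g *m g'); rewrite ?mulmxA; auto.
have [rv ru] := pair_decomposition s hyp.
(* The component of [s] off the plane supplies a third frame vector before Gram-Schmidt starts,
   which gives [2 <= q]. *)
set r := s - _ - _ in rv ru.
have r0 : r != 0 by rewrite /r subr_eq0 subr_eq; apply/eqP; rewrite addrC.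
have cols := standard_frame_col v u.
have rX j : real_span S (col j (standard_frame v u)).
  have rv' := real_span_gen Sv; have ru' := real_span_gen Su.
  case: (cols j) => ->; apply: (real_spanZ Sv (sqrtC2_real R)).
    exact: real_spanD.
  exact: (real_spanB Sv).
have rr : real_span S r.
  apply: (real_spanB Sv); last exact: (real_spanZ Sv (Sr _ _ Sv Ss) (real_span_gen Su)).
  apply: (real_spanB Sv); last exact: (real_spanZ Sv (Sr _ _ Su Ss) (real_span_gen Sv)).
  exact: real_span_gen.
have Xr : hadj (standard_frame v u) *m J *m r = 0.
  apply/matrixP=> i j; rewrite gramE [RHS]mxE.
  have -> : col j r = r by apply/colP=> l; rewrite mxE ord1.
  by case: (cols i) => ->; rewrite ipZl !(ipDl, ipNl) rv ru; ring.
have [X3 [X3o rX3 vuX3]] := real_frame_extend hyp Sv Xo rX vuX rr Xr r0.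
have [q [Y [q2 Yo rY vuY cY]]] := real_gram_schmidt hyp (ex_intro _ v Sv) Sr X3o rX3 vuX3.
exists q; split=> //.
have eq : (n - q + q.+1 = n.+1)%N by rewrite addnS (subnK (orthoframe_leq Yo)).
have stab g : Gam g -> exists2 B, g *m Y = Y *m B & forall i j, B i j \is Num.real.
  by move=> Gg; apply: (real_span_frame_action Sr _ rY cY) => t; apply: gS.
have [k [ks kG]] := block_conjugation sub eq hyp Yo vuY stab.
exists k; split=> // g Gg; have [A [B [UA UB rB dAB gE]]] := kG g Gg.
exists eq, A, B; split=> //; split; last first.
  by split=> //; rewrite gE det_cast det_ublock.
split=> //; rewrite -[RHS]UB; congr (_ *m _ *m _).
by apply/matrixP=> i j; rewrite hadjE mxE; apply/esym/CrealP.
Qed.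
End Dichotomy.

Lemma trace_field_trace (R : realType) N (G : 'M[R[i]]_N -> Prop) g :
  G g -> trace_field G (\tr g).
Proof. by move=> Gg S _; apply. Qed.

Local Open Scope complex_scope.

Theorem theorem3p9 (R : realType) (n : nat) (Gam : 'M[R[i]]_n.+1 -> Prop) :
  is_subgroup_SU_n1 Gam -> discrete_set Gam -> nonelementary Gam ->
  (forall x, trace_field Gam x -> x \is Num.real) ->
  (exists m : nat, (2 <= m)%N /\ conj_into Gam (inSUO m)) \/
  conj_into Gam (@inSU_SU11 R n).
Proof.
move=> sub disc nonelem tf.
apply: (real_trace_dichotomy sub disc nonelem) => g Gg.
by apply: tf; exact: trace_field_trace.
Qed.
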